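(* Let $n\ge2$, let $\gamma$ be a half-area $2n$-polygon and let $i$ be an index. The following statements are equivalent: (1) $\gamma(i)$ is a half-area vertex of $\gamma$; (2) the midpoint $\mathcal{M}(i)$ is outside the (closed) segment $\mathcal{E}(i)$; (3) $\mathcal{M}(i)$ is a cusp of $\mathcal{M}$; (4) $\mathcal{H}(i)$ is a cusp of $\mathcal{H}$.
   Context: Indices are taken modulo $2n$. $[A,B]$ denotes the determinant of the matrix with columns $A,B\in\mathbb{R}^2$. A convex $2n$-polygon is given by $2n$ distinct points $\gamma(1),\dots,\gamma(2n)\in\mathbb{R}^2$, listed in cyclic order along the boundary of a convex polygonal region with nonempty interior whose boundary is the union of the sides $\gamma(i)\gamma(i+1)$ (collinear consecutive vertices are allowed). It is a half-area polygon if, for every $i$, the line $l(i)$ through $\gamma(i)$ and $\gamma(i+n)$ divides the region into two parts of equal area. Put $\gamma'(i+\tfrac12)=\gamma(i+1)-\gamma(i)$ and $\delta(i+\tfrac12)=[\gamma'(i+\tfrac12),\gamma'(i+n+\tfrac12)]$. The vertex $\gamma(i)$ is a half-area vertex if $\delta(i-\tfrac12)\cdot\delta(i+\tfrac12)<0$. Discrete envelope $\mathcal{E}$: the polygon with vertices $\mathcal{E}(i+\tfrac12)=l(i)\cap l(i+1)$ (a single point); $\mathcal{E}(i)$ denotes the closed (possibly degenerate) segment from $\mathcal{E}(i-\tfrac12)$ to $\mathcal{E}(i+\tfrac12)$, which lies on $l(i)$. Mid-points envelope $\mathcal{M}$: the polygon with vertices $\mathcal{M}(i)=\tfrac12(\gamma(i)+\gamma(i+n))$;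 $\mathcal{M}(i+\tfrac12)$ denotes the segment from $\mathcal{M}(i)$ to $\mathcal{M}(i+1)$. Hyperbolic envelope $\mathcal{H}$: the envelope of all bisecting lines of the polygon (lines through boundary points dividing the region into two parts of equal area). It is the concatenation of the arcs $\mathcal{H}(i+\tfrac12)$, where $\mathcal{H}(i+\tfrac12)$ is the envelope of the bisecting lines with endpoints on the sides $\gamma(i)\gamma(i+1)$ and $\gamma(i+n)\gamma(i+n+1)$: if these sides are not parallel it is the arc, from $\mathcal{M}(i)$ to $\mathcal{M}(i+1)$, of a branch of a hyperbola tangent to $l(i)$ at $\mathcal{M}(i)$ and to $l(i+1)$ at $\mathcal{M}(i+1)$ and having the lines supporting the two sides as asymptotes; if they are parallel, it degenerates to the point $\mathcal{M}(i)=\mathcal{M}(i+1)$. We write $\mathcal{H}(i)=\mathcal{M}(i)$ for the common endpoint of $\mathcal{H}(i-\tfrac12)$ and $\mathcal{H}(i+\tfrac12)$. Cusps: $\mathcal{M}(i)$ is a cusp of $\mathcal{M}$ if the line $l(i)$ separates the segments $\mathcal{M}(i-\tfrac12)$ and $\mathcal{M}(i+\tfrac12)$; $\mathcal{H}(i)$ is a cusp of $\mathcal{H}$ if $l(i)$ separates the arcs $\mathcal{H}(i-\tfrac12)$ and $\mathcal{H}(i+\tfrac12)$. Here ''separates'' means that, after removing the common endpoint $\mathcal{M}(i)$, the two sets are nonempty and lie in opposite open half-planes bounded by $l(i)$. *)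

(* Defs.v *)
From HB Require Import structures.
From mathcomp Require Import all_boot all_order all_algebra.
From mathcomp Require Import all_classical all_reals all_analysis.

Set Implicit Arguments.
Unset Strict Implicit.
Unset Printing Implicit Defensive.

Import Order.TTheory GRing.Theory Num.Theory.
Import numFieldNormedType.Exports.

Local Open Scope classical_set_scope.
Local Open Scope ring_scope.

Section Plane.
Context {R : realType}.

Definition plane : Type := (R * R)%type.

Implicit Types (a b p : plane) (K S T : set plane).

Definition det a b : R := a.1 * b.2 - a.2 * b.1.

Definition midpoint a b : plane := 2^-1 *: (a + b).

Definition seg a b : set plane :=
  [set (1 - t) *: a + t *: b | t in `[0, 1]%classic].

(* The line through a and b, and the two open half-planes it bounds.  They are
   only meaningful for a <> b: line a a is the whole plane. *)
Definition line a b : set plane := [set p | det (b - a) (p - a) = 0].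
Definition left_side a b : set plane := [set p | 0 < det (b - a) (p - a)].
Definition right_side a b : set plane := [set p | det (b - a) (p - a) < 0].

Definition boundary K : set plane := closure K `\` interior K.

Definition area (S : set plane) : \bar R :=
  ((@lebesgue_measure R) \x (@lebesgue_measure R))%E S.

Definition bisects K a b : Prop :=
  a != b /\ area (K `&` left_side a b) = area (K `&` right_side a b).

Definition separates a b p S T : Prop :=
  [/\ S `\ p !=set0, T `\ p !=set0
    & (S `\ p `<=` left_side a b /\ T `\ p `<=` right_side a b)
   \/ (S `\ p `<=` right_side a b /\ T `\ p `<=` left_side a b)].

(* Envelope of a family L of lines, each one given by a pair of points: the
   limits of the intersection points of a line l of L with other lines of L
   tending to l. *)
Definition envelope (L : set (plane * plane)) : set plane :=
  [set p | exists2 l, L l &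
    exists (m : nat -> plane * plane) (q : nat -> plane),
      [/\ forall k, L (m k) /\ line (m k).1 (m k).2 <> line l.1 l.2,
          forall k, (line l.1 l.2 `&` line (m k).1 (m k).2) (q k),
          m @ \oo --> l
        & q @ \oo --> p]].

End Plane.

Arguments plane : clear implicits.

(* The vertices are indexed by 'Z_(2 * n), that is, modulo 2 * n (for n >= 1).
   An object attached to the half-integer i + 1/2 is indexed by i, so that the
   index i - 1/2 becomes i - 1. *)
Section Polygon.
Context {R : realType} {n : nat}.

Implicit Types (g : 'Z_(2 * n) -> plane R) (K : set (plane R))
  (i : 'Z_(2 * n)).

Definition opp_index i : 'Z_(2 * n) := i + n%:R.

Definition side g i : set (plane R) := seg (g i) (g (i + 1)).

(* K is the region.  The last condition says that the closed path
   g 0, g 1, ..., g (2n - 1), g 0 runs through each boundary point only once,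
   i.e. that the vertices are listed in cyclic order along the boundary; without
   it the path could go back and forth between collinear vertices. *)
Definition convex_polygon g K : Prop :=
  [/\ injective g,
      compact K /\ convex_set (K : set (convex_lmodType (R * R)%type)),
      interior K !=set0,
      boundary K = \bigcup_i side g i
    & trivIset setT (fun i => side g i `\ g (i + 1))].

Definition half_area_polygon g K : Prop :=
  convex_polygon g K /\ forall i, bisects K (g i) (g (opp_index i)).

(* bisector g i = l(i) *)
Definition bisector g i : set (plane R) := line (g i) (g (opp_index i)).

(* edge g i = gamma'(i + 1/2), delta g i = delta(i + 1/2) *)
Definition edge g i : plane R := g (i + 1) - g i.
Definition delta g i : R := det (edge g i) (edge g (opp_index i)).

Definition half_area_vertex g i : Prop := delta g (i - 1) * delta g i < 0.

(* E_vertex g i = E(i + 1/2), the intersection point of l(i) and l(i+1); for a half-area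
   polygon these lines meet in a single point. *)
Definition E_vertex g i : plane R := get (bisector g i `&` bisector g (i + 1)).
Definition E_seg g i : set (plane R) := seg (E_vertex g (i - 1)) (E_vertex g i).

(* M_seg g i = M(i + 1/2) *)
Definition M g i : plane R := midpoint (g i) (g (opp_index i)).
Definition M_seg g i : set (plane R) := seg (M g i) (M g (i + 1)).

(* H_arc g K i = H(i + 1/2): the envelope of the bisecting lines with endpoints
   on the opposite sides i + 1/2 and i + n + 1/2. *)
Definition side_bisectors g K i : set (plane R * plane R) :=
  [set ab | [/\ side g i ab.1, side g (opp_index i) ab.2 & bisects K ab.1 ab.2]].
Definition H_arc g K i : set (plane R) := envelope (side_bisectors g K i).

Definition M_cusp g i : Prop :=
  separates (g i) (g (opp_index i)) (M g i) (M_seg g (i - 1)) (M_seg g i).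
Definition H_cusp g K i : Prop :=
  separates (g i) (g (opp_index i)) (M g i) (H_arc g K (i - 1)) (H_arc g K i).

End Polygon.

(* Main.v *)
Require Import Defs.
From HB Require Import structures.
From mathcomp Require Import all_boot all_order all_algebra.
From mathcomp Require Import all_classical all_reals all_analysis.
From mathcomp Require Import ring lra measurable_realfun measurable_fun_approximation.

(** Why the theorem holds.  Write A, A' for the vertices i, i+1 and B, B' for
the vertices i+n, i+n+1; put e = A' - A, f = B' - B, and let d = [e, f] be the
number delta attached to this pair of opposite sides.  The proof shows that the
sign of d alone decides on which side of l(i) and of l(i+1) every envelope lies
between the two lines, and then compares the pairs at i - 1 and at i.

The link between areas and determinants is [area_fan_right]: turning a chord
around one of its endpoints moves a triangle from one side of it to the other.
Turning A B first into a B and then into a b, where a = A + s e and b = B + t f,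
gives [bisects_chordP]: the chord a b bisects the region if and only if
s D = t (G - s d), where D = [e, B - A] and G = [f, A - B] are both positive
when the boundary is oriented with the region on the left.  Since A' B' bisects,
G = D + d; so A A' B B' is a trapezoid with A B' parallel to A' B, and
everything can be read off it.

- The diagonals A B and A' B' cross at a point whose displacement from the
  midpoint M(i) is a positive multiple of d (B - A), and from M(i+1) a positive
  multiple of - d (B' - A') ([meets_at_facing]).  Hence the two endpoints of the
  segment E(i), which come from the pairs at i - 1 and at i, are on the same side
  of M(i) on l(i) exactly when the two values of d have strictly opposite signs.

- Two bisecting chords a b and a' b' also form a trapezoid, and their crossing
  point tends to the midpoint of a b as a' b' tends to a b.  The arc of the
  hyperbolic envelope is therefore the set of the midpoints of the bisecting
  chords ([envelope_midpoint], [midpoint_in_envelope]).  The midpoint of a b is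
  on the left of A B by s t d / 2 and on the left of A' B' by
  (1 - s) (1 - t) d / 2: the arc stays on the side of both lines given by the
  sign of d, and so does its chord, the segment from M(i) to M(i+1).

The predicate [sided] records this last property; [separates_sided] deduces the
two statements on cusps from it.  What remains is convex geometry: each
side supports the region, all sides have the region on the same hand
([orient_ex]), and no bisecting line carries a side. *)

Set Implicit Arguments.
Unset Strict Implicit.
Unset Printing Implicit Defensive.

Import Order.TTheory GRing.Theory Num.Theory.
Import numFieldNormedType.Exports.

Local Open Scope classical_set_scope.
Local Open Scope ring_scope.

Local Notation plane_convex K :=
  (convex_set (K : set (convex_lmodType (_ * _)%type))).

(** * Area and affine maps *)

Section Affine1.
Context {R : realType}.
Notation mu := (@lebesgue_measure R).

Lemma measurable_fun_affine (k c : R) :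
  measurable_fun [set: measurableTypeR R]
    (fun y : measurableTypeR R => k * y + c : measurableTypeR R).
Proof.
apply: measurable_funD; last exact: measurable_cst.
apply: measurable_funM; first exact: measurable_cst.
exact: measurable_id.
Qed.

(** Both sides are measures in X, so it suffices to compare them on half-open
intervals. *)
Lemma lebesgue_measure_affine (k c : R) (X : set (measurableTypeR R)) : k != 0 ->
  measurable X ->
  mu X = (`|k|%:E * mu ((fun y => k * y + c)%R @^-1` X))%E.
Proof.
move=> k0 mX.
pose f : measurableTypeR R -> measurableTypeR R := fun y => k * y + c.
have mf : measurable_fun setT f by exact: measurable_fun_affine.
pose m0 mf0 := mscale (NngNum (normr_ge0 k)) (pushforward mu f) mf0.
pose m := m0 mf.
rewrite (_ : (_ * _)%E = m X) //.
apply: (@lebesgue_measure_unique _ m) => // _ [[a b]] /= _ <-.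
rewrite /m /m0 /mscale /=/pushforward.
have [/= kp|kn|/esym/eqP] := ltrgtP 0 k; last by rewrite (negPf k0).
- rewrite (_ : f @^-1` _ = `](a - c) / k, (b - c) / k]%classic); last first.
    apply/seteqP; split => x /=; rewrite /f !in_itv /= ltr_pdivrMr // ler_pdivlMr // =>
      /andP[? ?]; lra.
  rewrite !lebesgue_measure_itv /= !lte_fin ltr_pM2r ?invr_gt0// ltrD2r.
  case: ifP => _; last by rewrite mule0.
  rewrite gtr0_norm// -!EFinB -EFinM; congr (_%:E); field; exact: k0.
- rewrite (_ : f @^-1` _ = `[(b - c) / k, (a - c) / k[%classic); last first.
    apply/seteqP; split => x /=; rewrite /f !in_itv /= ltr_ndivlMr // ler_ndivrMr // =>
      /andP[? ?]; lra.
  rewrite !lebesgue_measure_itv /= !lte_fin ltr_nM2r ?invr_lt0// ltrD2r.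
  case: ifP => _; last by rewrite mule0.
  rewrite ltr0_norm// -!EFinB -EFinM; congr (_%:E); field; exact: k0.
Qed.
End Affine1.

Section AffineArea.
Context {R : realType}.
Notation mu := (@lebesgue_measure R).
Local Notation P2 := (measurableTypeR R * measurableTypeR R)%type.
Implicit Types S : set (plane R).

Lemma measurable_fun_affine_form (a b c : R) :
  measurable_fun [set: P2] (fun p : P2 => a * p.1 + b * p.2 + c : measurableTypeR R).
Proof.
apply: measurable_funD; last exact: measurable_cst.
by apply: measurable_funD; apply: measurable_funM => //; exact: measurable_cst.
Qed.

Definition affine_map (a b c d e f : R) (p : plane R) : plane R :=
  (a * p.1 + b * p.2 + c, d * p.1 + e * p.2 + f).

Lemma measurable_affine_preimage a b c d e f S : measurable (S : set P2) ->
  measurable (affine_map a b c d e f @^-1` S : set P2).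
Proof.
move=> mS; rewrite -[X in measurable X]setTI.
by apply: measurable_fun_pair => //; exact: measurable_fun_affine_form.
Qed.

Lemma area_product_swap S : measurable (S : set P2) -> area S = (mu \x^ mu)%E S.
Proof.
move=> mS; apply: (@product_measure_unique _ _ _ _ _ mu mu (mu \x^ mu)%E) => //.
by move=> A B mA mB; exact: product_measure2E.
Qed.

(** On each vertical line the map is affine with slope b, so this is the
one-dimensional case integrated over the slices. *)
Lemma area_shear_y a b c S : b != 0 -> measurable (S : set P2) ->
  area S = (`|b|%:E * area (affine_map 1 0 0 a b c @^-1` S))%E.
Proof.
move=> b0 mS; rewrite /area /product_measure1.
have mT := measurable_affine_preimage 1 0 0 a b c mS.
rewrite -ge0_integralZl//; last exact: measurable_fun_xsection.
apply: eq_integral => x _ /=.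
rewrite (lebesgue_measure_affine (a * x + c) b0); last exact: measurable_xsection.
congr (_ * mu _)%E; apply/seteqP; split => y;
 rewrite /xsection /= !inE /affine_map /= !mul1r mul0r !addr0 => H;
 by move: H; rewrite addrA [b * y + _]addrC.
Qed.

Lemma area_shear_x a b c S : a != 0 -> measurable (S : set P2) ->
  area S = (`|a|%:E * area (affine_map a b c 0 1 0 @^-1` S))%E.
Proof.
move=> b0 mS.
have mT := measurable_affine_preimage a b c 0 1 0 mS.
rewrite !area_product_swap // /product_measure2.
rewrite -ge0_integralZl//; last exact: measurable_fun_ysection.
apply: eq_integral => x _ /=.
rewrite (lebesgue_measure_affine (b * x + c) b0); last exact: measurable_ysection.
congr (_ * mu _)%E; apply/seteqP; split => y;
 rewrite /ysection /= !inE /affine_map /= !mul1r mul0r !addr0 add0r => H;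
 by move: H; rewrite addrA.
Qed.

(** When a is nonzero the map is a shear in the first coordinate followed by a
shear in the second one; otherwise composing with the shear
(x, y) |-> (x, x + y), which preserves areas, makes a nonzero. *)
Lemma area_affine a b c d e f S : a * e - b * d != 0 -> measurable (S : set P2) ->
  area S = (`|a * e - b * d|%:E * area (affine_map a b c d e f @^-1` S))%E.
Proof.
have main a' b' c' d' e' f' : a' != 0 -> a' * e' - b' * d' != 0 -> measurable (S : set P2) ->
  area S = (`|a' * e' - b' * d'|%:E * area (affine_map a' b' c' d' e' f' @^-1` S))%E.
  move=> a0 det0 mS.
  have k0 : e' - b' * d' / a' != 0.
    apply: contra det0 => /eqP H; apply/eqP.
    have -> : a' * e' - b' * d' = a' * (e' - b' * d' / a') by field.
    by rewrite H mulr0.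
  rewrite (area_shear_y (d' / a') (f' - d' * c' / a') k0 mS).
  rewrite (area_shear_x b' c' a0); last exact: measurable_affine_preimage.
  rewrite muleA -EFinM -normrM; congr (`| _ |%:E * area _)%E; first by field.
  rewrite -comp_preimage; apply: (congr1 (fun h => h @^-1` S)).
  by apply/funext => -[x y]; rewrite /affine_map/=; congr pair; field.
have [->|a0] := eqVneq a 0; last exact: main.
move=> det0 mS.
have b0 : b != 0 by apply: contra det0 => /eqP ->; apply/eqP; ring.
rewrite (main (0 + b) b c (d + e) e f); rewrite ?add0r//; last first.
  by move: det0; rewrite (_ : _ - _ = 0 * e - b * d)//; ring.
rewrite (_ : b * e - b * (d + e) = 0 * e - b * d); last ring.
congr (_ * _)%E.
rewrite [in RHS](area_shear_y 1 0 (oner_neq0 _)); last first.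
  exact: (measurable_affine_preimage _ _ _ _ _ _ mS).
rewrite normr1 mul1e; congr area; rewrite -comp_preimage; apply: (congr1 (fun h => h @^-1` S)).
by apply/funext => -[x y]; rewrite /affine_map/=; congr pair; ring.
Qed.
End AffineArea.

(** * Measurable plane sets and the area of a triangle *)

Section MeasurableSets.
Context {R : realType}.
Notation mu := (@lebesgue_measure R).
Local Notation P2 := (measurableTypeR R * measurableTypeR R)%type.
Implicit Types S K U : set (plane R).

Lemma measurable_half_gt (a b c : R) :
  measurable ([set p : plane R | 0 < a * p.1 + b * p.2 + c] : set P2).
Proof.
rewrite [X in measurable X](_ : _ =
  [set: P2] `&` (fun p : P2 => a * p.1 + b * p.2 + c : measurableTypeR R) @^-1` `]0, +oo[).
  by apply: measurable_fun_affine_form => //; exact: measurable_itv.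
by rewrite setTI; apply/seteqP; split => p /=; rewrite in_itv/= andbT.
Qed.

Lemma measurable_half_ge (a b c : R) :
  measurable ([set p : plane R | 0 <= a * p.1 + b * p.2 + c] : set P2).
Proof.
rewrite [X in measurable X](_ : _ =
  [set: P2] `&` (fun p : P2 => a * p.1 + b * p.2 + c : measurableTypeR R) @^-1` `[0, +oo[).
  by apply: measurable_fun_affine_form => //; exact: measurable_itv.
by rewrite setTI; apply/seteqP; split => p /=; rewrite in_itv/= andbT.
Qed.

Lemma measurable_box (x y e : R) : measurable (ball x e `*` ball y e : set P2).
Proof. by apply: measurableX; exact: measurable_ball. Qed.

(** There are only countably many rational boxes contained in U, and they cover
U. *)
Lemma open_measurable_plane U : open U -> measurable (U : set P2).
Proof.
move=> oU.
pose box (q : rat * rat * nat) : set (plane R) :=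
  ball (ratr q.1.1 : R) q.2.+1%:R^-1 `*` ball (ratr q.1.2 : R) q.2.+1%:R^-1.
pose F (n : nat) : set (plane R) := if unpickle n is Some q then
   [set p | box q `<=` U /\ box q p] else set0.
rewrite (_ : U = \bigcup_n F n).
  apply: (@bigcup_measurable _ P2) => n _; rewrite /F.
  case: (unpickle n) => [q|]; last exact: measurable0.
  have [bU|nbU] := pselect (box q `<=` U).
    rewrite (_ : [set _ | _] = box q); first exact: measurable_box.
    by apply/seteqP; split => p /= // -[].
  rewrite (_ : [set _ | _] = set0); first exact: measurable0.
  by apply/seteqP; split => p /= // -[].
apply/seteqP; split => [p Up|p [n _]]; last first.
  by rewrite /F; case: (unpickle n) => [q [qU /qU]|].
have : nbhs p U by exact: open_nbhs_nbhs.
move=> /nbhs_ballP[e /= e0 peU].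
have [n ne] : exists n : nat, n.+1%:R^-1 < e / 2.
  have e20 : 0 < e / 2 by lra.
  have [n nP] := @ltr_add_invr _ 0 (e / 2) e20.
  by exists n; rewrite add0r in nP.
have n0 : 0 < n.+1%:R^-1 :> R by rewrite invr_gt0.
pose d : R := n.+1%:R^-1.
have {}n0 : 0 < d by [].
have {}ne : d < e / 2 by [].
have near (z : R) : exists q : rat, ball (ratr q : R) d z.
  have : z - d < z by rewrite ltrBlDr ltrDl.
  move=> /rat_in_itvoo[q]; rewrite inE /= => /itvP qz.
  have q1 : z - d < ratr q by rewrite qz.
  have q2 : ratr q < z by rewrite qz.
  by exists q; rewrite /ball/= ltr_norml; lra.
have [q1 q1P] := near p.1; have [q2 q2P] := near p.2.
(* the index is kept abstract, since computing it is expensive *)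
have [m mE] : exists m, F m = [set z | box (q1, q2, n) `<=` U /\ box (q1, q2, n) z].
  by exists (pickle (q1, q2, n)); rewrite /F pickleK.
exists m; first exact: I.
rewrite mE; split; last by split.
move=> [x y] [/= xP yP].
apply: peU; move: q1P q2P xP yP; rewrite -/d /ball/= => + + + +.
rewrite /ball/= !ltr_norml => /andP[? ?] /andP[? ?] /andP[? ?] /andP[? ?].
by split; rewrite /ball/= ltr_norml; lra.
Qed.

Lemma area_gt0 S (p : plane R) (e : R) : 0 < e -> measurable (S : set P2) ->
  ball p e `<=` S -> (0 < area S)%E.
Proof.
move=> e0 mS bS.
apply: (@lt_le_trans _ _ (area (ball p.1 e `*` ball p.2 e))).
  rewrite /area product_measure1E; try exact: measurable_ball.
  by rewrite /= !lebesgue_measure_ball ?ltW// -EFinM lte_fin mulr_gt0// mulrn_wgt0.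
apply: (@le_measure _ _ _ (mu \x mu)%E); rewrite ?inE//; exact: measurable_box.
Qed.

Lemma area_bounded S (r : R) : measurable (S : set P2) ->
  (forall p, S p -> `|p.1| <= r /\ `|p.2| <= r) -> (area S < +oo)%E.
Proof.
move=> mS bS.
have mI : measurable ([set` `[- r, r]] : set (measurableTypeR R)).
  exact: measurable_itv.
apply: (@le_lt_trans _ _ (area ([set` `[- r, r]] `*` [set` `[- r, r]]))).
  apply: (@le_measure _ _ _ (mu \x mu)%E); rewrite ?inE//.
    exact: measurableX.
  by move=> p /bS /= []; rewrite !in_itv/= !ler_norml.
rewrite /area product_measure1E //= lebesgue_measure_itv/=.
by case: ifP => _; rewrite ?mule0 ?ltry// -EFinB -EFinM ltry.
Qed.

(** Two of the edges are included and one is not, so that the images of this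
triangle are exactly the differences of the two parts cut off by a turning chord
(see [area_fan_right]) and no null set has to be discarded. *)
Definition unit_triangle : set (plane R) :=
  [set p | [/\ 0 <= p.1, 0 < p.2 & p.1 + p.2 <= 1]].

Lemma measurable_unit_triangle : measurable (unit_triangle : set P2).
Proof.
rewrite (_ : unit_triangle =
  [set p : plane R | 0 <= 1 * p.1 + 0 * p.2 + 0] `&`
  ([set p : plane R | 0 < 0 * p.1 + 1 * p.2 + 0] `&`
  [set p : plane R | 0 <= -1 * p.1 + -1 * p.2 + 1])).
  by do 2?[apply: measurableI]; [exact: measurable_half_ge|
    exact: measurable_half_gt|exact: measurable_half_ge].
apply/seteqP; split => p /=.
  by case=> ? ? ?; do ![split]; lra.
by case=> ? [? ?]; split; lra.
Qed.

(** Triangles are only compared with one another: the area of this one serves as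
a unit. *)
Lemma area_unit_triangle : exists2 c : R, 0 < c & area unit_triangle = c%:E.
Proof.
have a0 : (0 < area unit_triangle)%E.
  apply: (@area_gt0 _ (4^-1, 4^-1) 4^-1).
  - by rewrite invr_gt0.
  - exact: measurable_unit_triangle.
  - move=> [x y] [/=]; rewrite /ball/= !ltr_norml => /andP[? ?] /andP[? ?].
    by split => /=; lra.
have aoo : (area unit_triangle < +oo)%E.
  apply: (@area_bounded _ 1); first exact: measurable_unit_triangle.
  by move=> p [? ? ?]; rewrite !ler_norml; split; apply/andP; split; lra.
exists (fine (area unit_triangle)); last first.
  by rewrite fineK// ge0_fin_numE// ltW.
by rewrite fine_gt0// a0.
Qed.

Lemma compact_plane_measurable K : compact K -> measurable (K : set P2).
Proof.
move=> cK; rewrite -[K]setCK; apply: measurableC.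
apply: open_measurable_plane; apply: closed_openC; exact: compact_closed.
Qed.

Lemma compact_plane_area K : compact K -> (area K < +oo)%E.
Proof.
move=> cK; have /compact_bounded [M [_ MK]] := cK.
apply: (@area_bounded _ (M + 1)); first exact: compact_plane_measurable.
move=> p Kp.
have : `|p : (R * R)%type| <= M + 1 by apply: MK => //; rewrite ltrDl.
by rewrite prod_normE ge_max => /andP[].
Qed.

End MeasurableSets.

(** * Areas cut off by a turning chord *)

Section ChordAreas.
Context {R : realType}.
Notation mu := (@lebesgue_measure R).
Local Notation P2 := (measurableTypeR R * measurableTypeR R)%type.
Implicit Types (S K U : set (plane R)) (p q a b A B f : plane R).

Lemma scale_realE (k x : R) : k *: x = k * x. Proof. by []. Qed.

Lemma plane_eq p q : p.1 = q.1 -> p.2 = q.2 -> p = q.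
Proof. by case: p q => ? ? [? ?] /= -> ->. Qed.

Lemma measurable_left_side a b : measurable (left_side a b : set P2).
Proof.
rewrite (_ : left_side a b = [set p : plane R | 0 < (a.2 - b.2) * p.1 + (b.1 - a.1) * p.2
  + ((b.2 - a.2) * a.1 - (b.1 - a.1) * a.2)]); first exact: measurable_half_gt.
by apply/funext => p /=; rewrite /left_side /det /=; congr (is_true (0 < _)); ring.
Qed.

Lemma right_sideE a b : right_side a b = left_side b a.
Proof.
apply/funext => p; rewrite /right_side/left_side/det /=.
rewrite -oppr_gt0; congr (is_true (0 < _)); ring.
Qed.

Lemma convex_setP K p q t : plane_convex K ->
  0 <= t <= 1 -> K p -> K q -> K ((1 - t) *: p + t *: q).
Proof.
move=> cK /andP[t0 t1] Kp Kq.
have := cK q p (Itv01 t0 t1); rewrite !inE => /(_ Kq Kp).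
by rewrite /conv/= addrC.
Qed.

Lemma convex_triangle K A a B x y : plane_convex K ->
  K A -> K a -> K B -> 0 <= x -> 0 <= y -> x + y <= 1 ->
  K (B + x *: (A - B) + y *: (a - B)).
Proof.
move=> cK KA Ka KB x0 y0 xy1.
have [xy0|xy0] := eqVneq (x + y) 0.
  have -> : x = 0 by lra.
  have -> : y = 0 by lra.
  by rewrite !scale0r !addr0.
have t01 : 0 <= y / (x + y) <= 1.
  have : 0 < x + y by rewrite lt_neqAle eq_sym xy0 addr_ge0.
  move=> xyp; rewrite divr_ge0 ?ler_pdivrMr//; lra.
have K1 := convex_setP cK t01 KA Ka.
have s01 : 0 <= x + y <= 1 by apply/andP; split; lra.
have := convex_setP cK s01 KB K1; congr K.
by apply: plane_eq => /=; rewrite !scale_realE; field.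
Qed.

Lemma area_triangle_at B u v S : det u v != 0 -> measurable (S : set P2) ->
  (forall q, S (B + q.1 *: u + q.2 *: v) <-> unit_triangle q) ->
  area S = (`|det u v|%:E * area (@unit_triangle R))%E.
Proof.
move=> duv mS Sq.
rewrite (@area_affine R u.1 v.1 B.1 u.2 v.2 B.2 S) //;
  last by move: duv; rewrite /det [u.2 * _]mulrC.
congr (`| _ |%:E * area _)%E; first by rewrite /det; ring.
apply/seteqP; split => q /=.
- move=> H; apply/Sq; move: H; congr S; rewrite /affine_map.
  by congr pair => /=; rewrite !scale_realE; ring.
- move=> /Sq; congr S; rewrite /affine_map.
  by congr pair => /=; rewrite !scale_realE; ring.
Qed.

Section Fan.
Variables (K : set (plane R)) (A a B f : plane R).
Hypotheses (compK : compact K) (convK : plane_convex K).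
Hypotheses (KA : K A) (Ka : K a) (KB : K B).
Hypothesis supB : forall p, K p -> 0 <= det f (p - B).
Hypotheses (fA : 0 < det f (A - B)) (fa : 0 < det f (a - B)).
Hypothesis supA : forall p, K p -> 0 <= det (a - A) (p - A).
Hypothesis D0 : 0 < det (a - A) (B - A).

Let mK : measurable (K : set P2). Proof. exact: compact_plane_measurable. Qed.

(** A point of K violating this would lie in the cone opposite to the triangle
at its apex B, hence beyond the supporting line of direction f through B. *)
Lemma fan_right_mono p : K p -> det (B - a) (p - a) < 0 -> det (B - A) (p - A) < 0.
Proof.
move=> /supB; move: fA fa D0; rewrite /det /=.
move=> h1 h2 h3 h4 h5.
set W := (X in X < 0).
have E : det (a - A) (B - A) * det f (p - B) =
   det (B - a) (p - a) * det f (A - B) - W * det f (a - B).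
  by rewrite /W /det /=; ring.
rewrite ltNge; apply/negP => W0; move: E; rewrite /det /=.
nra.
Qed.

Lemma fan_left_mono p : K p -> 0 < det (B - A) (p - A) -> 0 < det (B - a) (p - a).
Proof.
move=> /supB; move: fA fa D0; rewrite /det /=.
move=> h1 h2 h3 h4 h5.
set W := (X in 0 < X).
have E : det (a - A) (B - A) * det f (p - B) =
   W * det f (A - B) - det (B - A) (p - A) * det f (a - B).
  by rewrite /W /det /=; ring.
rewrite ltNge; apply/negP => W0; move: E; rewrite /det /=.
nra.
Qed.

(** When the endpoint of a chord from B slides from A to a, the part of K on its
right loses exactly the triangle A a B: the line A a supports K, so K does
not extend beyond the triangle between the two chords, and the triangle is in K
by convexity. *)
Lemma area_fan_right : area (K `&` right_side A B) =
  (area (K `&` right_side a B) + (det (a - A) (B - A))%:E * area (@unit_triangle R))%E.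
Proof.
pose S := (K `&` right_side A B) `\` right_side a B.
have mS : measurable (S : set P2).
  by apply: measurableD; [apply: measurableI => //|]; rewrite right_sideE;
    exact: measurable_left_side.
have -> : K `&` right_side A B = (K `&` right_side a B) `|` S.
  apply/seteqP; split => p.
    move=> [Kp pAB]; have [paB|paB] := pselect (right_side a B p); first by left; split.
    by right; split.
  case=> [[Kp pa]|[] //]; split => //; exact: fan_right_mono.
rewrite /area (@measureU _ _ _ (mu \x mu)%E) //.
- congr (_ + _)%E.
  have -> : det (a - A) (B - A) = `|det (A - B) (a - B)|.
    have -> : det (A - B) (a - B) = det (a - A) (B - A) by rewrite /det /=; ring.
    by rewrite gtr0_norm.
  apply: (@area_triangle_at B) => //.
    have -> : det (A - B) (a - B) = det (a - A) (B - A) by rewrite /det /=; ring.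
    by rewrite gt_eqF.
  (* in the frame (A - B, a - B) at B, the conditions defining S become
     those of [unit_triangle] *)
  move=> q; pose P := B + q.1 *: (A - B) + q.2 *: (a - B).
  change (S P <-> unit_triangle q).
  have E1 : det (B - A) (P - A) = - (q.2 * det (a - A) (B - A)).
    by rewrite /P /det /= !scale_realE; ring.
  have E2 : det (B - a) (P - a) = q.1 * det (a - A) (B - A).
    by rewrite /P /det /= !scale_realE; ring.
  have E3 : det (a - A) (P - A) = (1 - q.1 - q.2) * det (a - A) (B - A).
    by rewrite /P /det /= !scale_realE; ring.
  split.
    move=> [[/supA]]; rewrite /right_side /= E1 E2 E3.
    rewrite pmulr_lge0// oppr_lt0 pmulr_lgt0// => ? ? /negP.
    by rewrite -leNgt pmulr_lge0// => ?; split => //; lra.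
  move=> [q1 q2 q12]; split; last first.
    by rewrite /right_side /= E2; apply/negP; rewrite -leNgt pmulr_lge0.
  split; first by apply: convex_triangle => //; exact: ltW.
  by rewrite /right_side /= E1 oppr_lt0 pmulr_lgt0.
- by apply: measurableI => //; rewrite right_sideE; exact: measurable_left_side.
- by apply/seteqP; split => p // -[[_ h] [_]].
Qed.

Lemma area_fan_left : area (K `&` left_side a B) =
  (area (K `&` left_side A B) + (det (a - A) (B - A))%:E * area (@unit_triangle R))%E.
Proof.
pose S := (K `&` left_side a B) `\` left_side A B.
have mS : measurable (S : set P2).
  by apply: measurableD; [apply: measurableI => //|];
    exact: measurable_left_side.
have -> : K `&` left_side a B = (K `&` left_side A B) `|` S.
  apply/seteqP; split => p.
    move=> [Kp pAB]; have [paB|paB] := pselect (left_side A B p); first by left; split.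
    by right; split.
  case=> [[Kp pa]|[] //]; split => //; exact: fan_left_mono.
rewrite /area (@measureU _ _ _ (mu \x mu)%E) //.
- congr (_ + _)%E.
  have -> : det (a - A) (B - A) = `|det (a - B) (A - B)|.
    have -> : det (a - B) (A - B) = - det (a - A) (B - A) by rewrite /det /=; ring.
    by rewrite normrN gtr0_norm.
  apply: (@area_triangle_at B) => //.
    have -> : det (a - B) (A - B) = - det (a - A) (B - A) by rewrite /det /=; ring.
    by rewrite oppr_eq0 gt_eqF.
  move=> q; pose P := B + q.1 *: (a - B) + q.2 *: (A - B).
  change (S P <-> unit_triangle q).
  have E1 : det (B - A) (P - A) = - (q.1 * det (a - A) (B - A)).
    by rewrite /P /det /= !scale_realE; ring.
  have E2 : det (B - a) (P - a) = q.2 * det (a - A) (B - A).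
    by rewrite /P /det /= !scale_realE; ring.
  have E3 : det (a - A) (P - A) = (1 - q.1 - q.2) * det (a - A) (B - A).
    by rewrite /P /det /= !scale_realE; ring.
  split.
    move=> [[/supA]]; rewrite /left_side /= E1 E2 E3.
    rewrite pmulr_lge0// pmulr_lgt0// => ? ? /negP.
    by rewrite -leNgt oppr_le0 pmulr_lge0// => ?; split => //; lra.
  move=> [q1 q2 q12]; split; last first.
    by rewrite /left_side /= E1; apply/negP; rewrite -leNgt oppr_le0 pmulr_lge0.
  split; first by apply: convex_triangle => //; exact: ltW.
  by rewrite /left_side /= E2 pmulr_lgt0.
- by apply: measurableI => //; exact: measurable_left_side.
- by apply/seteqP; split => p // -[[_ h] [_]].
Qed.
End Fan.
End ChordAreas.

(** * The bisecting chords between two opposite sides *)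

Section BisectingChords.
Context {R : realType}.
Notation mu := (@lebesgue_measure R).
Local Notation P2 := (measurableTypeR R * measurableTypeR R)%type.
Implicit Types (S K U : set (plane R)) (p q a b A B f : plane R).

Lemma area_side_fin K a b : compact K -> exists x : R, area (K `&` left_side a b) = x%:E.
Proof.
move=> cK.
have mK := compact_plane_measurable cK.
have h : (area (K `&` left_side a b) < +oo)%E.
  apply: le_lt_trans (compact_plane_area cK).
  apply: (@le_measure _ _ _ (mu \x mu)%E); rewrite ?inE//.
  by apply: measurableI => //; exact: measurable_left_side.
exists (fine (area (K `&` left_side a b))).
by rewrite fineK// ge0_fin_numE.
Qed.

Section Quad.
Variables (K : set (plane R)) (A A' B B' : plane R).
Hypotheses (compK : compact K) (convK : plane_convex K).

(** Both sides are oriented with K on their left.  The opposite orientation of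
the boundary is reduced to this one by exchanging A with A' and B with B'. *)
Record facing_sides : Prop := FacingSides {
  facing_A : K A; facing_A' : K A'; facing_B : K B; facing_B' : K B';
  facing_e : forall p, K p -> 0 <= det (A' - A) (p - A);
  facing_f : forall p, K p -> 0 <= det (B' - B) (p - B);
  facing_eB : 0 < det (A' - A) (B - A);
  facing_eB' : 0 < det (A' - A) (B' - A);
  facing_fA : 0 < det (B' - B) (A - B);
  facing_fA' : 0 < det (B' - B) (A' - B) }.

Hypothesis Q : facing_sides.
Hypothesis bisAB : bisects K A B.

Let D := det (A' - A) (B - A).
Let G := det (B' - B) (A - B).
Let d := det (A' - A) (B' - B).

Lemma convex_seg p q t : K p -> K q -> 0 <= t <= 1 -> K (p + t *: (q - p)).
Proof.
move=> Kp Kq t01; have := convex_setP convK t01 Kp Kq; congr K.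
by apply: plane_eq => /=; rewrite !scale_realE; ring.
Qed.

(** Passing from A B to a B and then to a b moves the triangle A a B from the
right to the left, and then the triangle a B b from the left to the right.  As A B
bisects K, so does a b if and only if these triangles have equal areas, which are
proportional to s D and to t (G - s d). *)
Lemma bisects_chordP s t : 0 <= s <= 1 -> 0 <= t <= 1 ->
  bisects K (A + s *: (A' - A)) (B + t *: (B' - B)) <-> s * D = t * G - s * t * d.
Proof.
move=> s01 t01; have /andP[s0 s1] := s01; have /andP[t0 t1] := t01.
set a := A + _; set b := B + _.
case: Q => KA KA' KB KB' He Hf eB eB' fA fA'.
have Ka : K a by exact: convex_seg.
have Kb : K b by exact: convex_seg.
have eb : 0 < det (A' - A) (b - a).
  have -> : det (A' - A) (b - a) = (1 - t) * D + t * det (A' - A) (B' - A).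
    by rewrite /D /det /= !scale_realE; ring.
  have := eB; have := eB'; rewrite -/D; nra.
have fa : 0 < det (B' - B) (a - B).
  have -> : det (B' - B) (a - B) = (1 - s) * G + s * det (B' - B) (A' - B).
    by rewrite /G /det /= !scale_realE; ring.
  have := fA; have := fA'; rewrite -/G; nra.
have ab : a != b.
  apply/eqP => ab; move: eb; rewrite ab subrr /det /= !mulr0 subrr ltxx //.
have aA : det (a - A) (B - A) = s * D by rewrite /D /det /= !scale_realE; ring.
have bB : det (b - B) (a - B) = t * (G - s * d).
  by rewrite /G /d /det /= !scale_realE; ring.
have [c c0 cE] := @area_unit_triangle R.
have step1 : area (K `&` right_side A B) = (area (K `&` right_side a B) + (s * D * c)%:E)%E /\
    area (K `&` left_side a B) = (area (K `&` left_side A B) + (s * D * c)%:E)%E.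
  have [s_eq0|sn0] := eqVneq s 0.
    have -> : a = A by rewrite /a s_eq0 scale0r addr0.
    by rewrite s_eq0 !mul0r !adde0.
  have sp : 0 < s by rewrite lt_neqAle eq_sym sn0.
  have supa p : K p -> 0 <= det (a - A) (p - A).
    move=> /He h; have -> : det (a - A) (p - A) = s * det (A' - A) (p - A).
      by rewrite /det /= !scale_realE; ring.
    exact: mulr_ge0.
  have D0 : 0 < det (a - A) (B - A) by rewrite aA mulr_gt0.
  split.
    by rewrite (area_fan_right compK convK KA Ka KB Hf fA fa supa D0) cE aA.
  by rewrite (area_fan_left compK convK KA Ka KB Hf fA fa supa D0) cE aA.
(* the chord now turns around a, so it is read from the moving end: left and right are exchanged *)
have step2 : area (K `&` right_side B a) =
     (area (K `&` right_side b a) + (t * (G - s * d) * c)%:E)%E /\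
    area (K `&` left_side b a) =
     (area (K `&` left_side B a) + (t * (G - s * d) * c)%:E)%E.
  have [t_eq0|tn0] := eqVneq t 0.
    have -> : b = B by rewrite /b t_eq0 scale0r addr0.
    by rewrite t_eq0 !mul0r !adde0.
  have tp : 0 < t by rewrite lt_neqAle eq_sym tn0.
  have supb p : K p -> 0 <= det (b - B) (p - B).
    move=> /Hf h; have -> : det (b - B) (p - B) = t * det (B' - B) (p - B).
      by rewrite /det /= !scale_realE; ring.
    exact: mulr_ge0.
  have supe p : K p -> 0 <= det (A' - A) (p - a).
    by move=> /He; congr (is_true (0 <= _)); rewrite /det /= !scale_realE; ring.
  have eBa : 0 < det (A' - A) (B - a).
    by move: eB; congr (is_true (0 < _)); rewrite /det /= !scale_realE; ring.
  have D0 : 0 < det (b - B) (a - B).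
    have -> : det (b - B) (a - B) = t * det (B' - B) (a - B).
      by rewrite /det /= !scale_realE; ring.
    by rewrite mulr_gt0.
  split.
    by rewrite (area_fan_right compK convK KB Kb Ka supe eBa eb supb D0) cE bB.
  by rewrite (area_fan_left compK convK KB Kb Ka supe eBa eb supb D0) cE bB.
have [_ halfAB] := bisAB; have [s1R s1L] := step1; have [s2R s2L] := step2.
move: halfAB s1R s1L s2R s2L; rewrite /bisects ab !right_sideE.
have [x1 ->] := area_side_fin A B compK.
have [x2 ->] := area_side_fin B A compK.
have [x3 ->] := area_side_fin a B compK.
have [x4 ->] := area_side_fin B a compK.
have [x5 ->] := area_side_fin a b compK.
have [x6 ->] := area_side_fin b a compK.
move=> [h1] [h2] [h3] [h4] [h5]; split.
  move=> [_ [h6]]; apply: (mulIf (x := c)); first by rewrite gt_eqF.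
  lra.
move=> h6; split=> //; congr EFin; nra.
Qed.

End Quad.
End BisectingChords.

(** * The envelope of the bisecting chords *)

Section ChordEnvelope.
Context {R : realType}.
Implicit Types (S K U : set (plane R)) (p q a b A B f u v w e : plane R).

Lemma detDr u v w : det u (v + w) = det u v + det u w.
Proof. by rewrite /det /=; ring. Qed.

Lemma detZr (k : R) u v : det u (k *: v) = k * det u v.
Proof. by rewrite /det /= !scale_realE; ring. Qed.

Lemma det_collinear e v w : det v w = 0 -> det e v *: w = det e w *: v.
Proof.
move=> vw; apply: plane_eq => /=; rewrite !scale_realE.
- have -> : det e v * w.1 = det e w * v.1 - det v w * e.1 by rewrite /det; ring.
  by rewrite vw mul0r subr0.
- have -> : det e v * w.2 = det e w * v.2 - det v w * e.2 by rewrite /det; ring.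
  by rewrite vw mul0r subr0.
Qed.

Lemma parallel_dot e v : det e v = 0 ->
  (e.1 ^+ 2 + e.2 ^+ 2) *: v = (e.1 * v.1 + e.2 * v.2) *: e.
Proof.
move=> /(det_collinear (- e.2, e.1)).
rewrite (_ : det _ e = - (e.1 ^+ 2 + e.2 ^+ 2)); last by rewrite /det /=; ring.
rewrite (_ : det _ v = - (e.1 * v.1 + e.2 * v.2)); last by rewrite /det /=; ring.
by rewrite !scaleNr => /oppr_inj.
Qed.

Lemma parallel_det (c k : R) e v w : c *: v = k *: e -> c * det v w = k * det e w.
Proof.
move=> E; have E1 := congr1 fst E; have E2 := congr1 snd E.
rewrite /= !scale_realE in E1 E2.
have -> : c * det v w = (c * v.1) * w.2 - (c * v.2) * w.1 by rewrite /det; ring.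
by rewrite E1 E2 /det -!mulrA -mulrBr.
Qed.

Lemma cvg_plane (F : nat -> plane R) p : (fun k => (F k).1) @ \oo --> p.1 ->
  (fun k => (F k).2) @ \oo --> p.2 -> F @ \oo --> p.
Proof.
move=> h1 h2.
have -> : F = (fun k => ((F k).1, (F k).2)) by apply/funext => k; case: (F k).
by case: p h1 h2 => p1 p2 /= h1 h2; exact: (cvg_pair h1 h2).
Qed.

Lemma cvg_fst_seq (T U : topologicalType) (F : nat -> T * U) (p : T * U) : F @ \oo --> p ->
  (fun k => (F k).1) @ \oo --> p.1.
Proof. by move=> h; apply: cvg_comp h _; apply: cvg_fst. Qed.

Lemma cvg_snd_seq (T U : topologicalType) (F : nat -> T * U) (p : T * U) : F @ \oo --> p ->
  (fun k => (F k).2) @ \oo --> p.2.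
Proof. by move=> h; apply: cvg_comp h _; apply: cvg_snd. Qed.

Lemma convex_gt0 (x y t : R) : 0 < x -> 0 < y -> 0 <= t <= 1 -> 0 < (1 - t) * x + t * y.
Proof. by move=> x0 y0 /andP[t0 t1]; nra. Qed.

Section Arc.
Variables (A A' B B' : plane R).
Let e := A' - A.
Let f := B' - B.
Let D := det e (B - A).
Let G := det f (A - B).
Let d := det e f.
Hypotheses (D0 : 0 < D) (G0 : 0 < G) (GD : G = D + d).
Let a_ (s : R) : plane R := A + s *: e.
Let b_ (t : R) : plane R := B + t *: f.

(** The equation found in [bisects_chordP]. *)
Definition bisecting_params s t := [/\ 0 <= s <= 1, 0 <= t <= 1 & s * D = t * G - s * t * d].

Lemma det_chord (s t : R) : det e (b_ t - a_ s) = D + t * d.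
Proof. by rewrite /b_ /a_ /D /d /det /= !scale_realE; ring. Qed.

Lemma det_chord_gt0 t : 0 <= t <= 1 -> 0 < D + t * d.
Proof.
move=> t01; rewrite (_ : D + t * d = (1 - t) * D + t * G); last by rewrite GD; ring.
exact: convex_gt0.
Qed.

Lemma det_foot_gt0 s : 0 <= s <= 1 -> 0 < G - s * d.
Proof.
move=> s01; rewrite (_ : G - s * d = (1 - s) * G + s * D); last by rewrite GD; ring.
exact: convex_gt0.
Qed.

Lemma bisecting_params_inj s t t' : bisecting_params s t -> bisecting_params s t' -> t = t'.
Proof.
move=> [s01 _ E] [_ _ E']; apply: (mulIf (x := G - s * d)).
  by rewrite gt_eqF// det_foot_gt0.
lra.
Qed.

Lemma bisecting_params_diff s t s' t' : bisecting_params s t -> bisecting_params s' t' ->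
  (s' - s) * (D + t' * d) = (t' - t) * (G - s * d).
Proof. by move=> [_ _ E] [_ _ E']; lra. Qed.

Lemma det_chord_chord (s t s' t' : R) : det (b_ t' - a_ s') (b_ t - a_ s) =
  - (t' - t) * (G - s * d) - (s' - s) * (D + t * d).
Proof. by rewrite /b_ /a_ /D /d /G /det /= !scale_realE; ring. Qed.

Lemma det_chord_foot (s s' t' : R) : det (b_ t' - a_ s') (a_ s - a_ s') = (s' - s) * (D + t' * d).
Proof. by rewrite /b_ /a_ /D /d /G /det /= !scale_realE; ring. Qed.

(** The triangles which two bisecting chords a b and a' b' cut off from each other have
equal areas, so a b' and a' b are parallel, and the crossing point q divides a b in
the ratio of the heights of b' and b above the line A A'.  Stated without any
division by s' - s, the identity passes to the limit s' -> s, where the two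
heights agree and q becomes the midpoint. *)
Lemma crossing_point s t s' t' q : bisecting_params s t -> bisecting_params s' t' -> s' != s ->
  det (b_ t - a_ s) (q - a_ s) = 0 -> det (b_ t' - a_ s') (q - a_ s') = 0 ->
  (det e (b_ t' - A) + det e (b_ t - A)) *: (q - a_ s) = det e (b_ t' - A) *: (b_ t - a_ s).
Proof.
move=> st st' ss' h h'.
have Ea x : det e (b_ x - A) = D + x * d by rewrite /b_ /D /d /det /= !scale_realE; ring.
rewrite !Ea.
have F1 := det_collinear e h; rewrite det_chord in F1.
set rho := det e (q - a_ s) in F1.
have qE : q - a_ s' = (q - a_ s) + (a_ s - a_ s') by rewrite addrA subrK.
have : (D + t * d) * det (b_ t' - a_ s') (q - a_ s') = 0 by rewrite h' mulr0.
rewrite qE detDr mulrDr -detZr F1 detZr det_chord_chord det_chord_foot => E.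
have I := bisecting_params_diff st st'.
have al0 : 0 < D + t * d by case: st => _ /det_chord_gt0.
have E2 : (s' - s) * (rho * (D + t' * d + (D + t * d))) =
  (s' - s) * ((D + t' * d) * (D + t * d)).
  have X : (t' - t) * (G - s * d) * rho = (s' - s) * (D + t' * d) * rho by rewrite I.
  lra.
have {}E2 : rho * (D + t' * d + (D + t * d)) = (D + t' * d) * (D + t * d).
  by apply: (mulfI (x := s' - s)) E2; rewrite subr_eq0.
have aln0 : D + t * d != 0 by rewrite gt_eqF.
apply: (scalerI aln0).
rewrite scalerA [(D + t * d) * _]mulrC -scalerA F1 scalerA [_ * rho]mulrC E2.
by rewrite scalerA mulrC.
Qed.

Lemma chord_lines_neq s t s' t' : bisecting_params s t -> bisecting_params s' t' -> s' != s ->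
  line (a_ s') (b_ t') <> line (a_ s) (b_ t).
Proof.
move=> st st' ss' H.
have : line (a_ s') (b_ t') (a_ s') by rewrite /line /= subrr /det /= !mulr0 subrr.
rewrite H /line /= => /eqP.
rewrite (_ : det _ _ = (s - s') * (D + t * d)); last first.
  by rewrite /b_ /a_ /D /d /G /det /= !scale_realE; ring.
rewrite mulf_eq0 subr_eq0 eq_sym (negPf ss') gt_eqF//.
by case: st => _ /det_chord_gt0.
Qed.

Definition bisecting_chords : set (plane R * plane R) :=
  [set ab | exists s t, bisecting_params s t /\ ab = (a_ s, b_ t)].

(** The limit of the identity of [crossing_point]. *)
Lemma envelope_midpoint p : envelope bisecting_chords p ->
  exists s t, bisecting_params s t /\ p = midpoint (a_ s) (b_ t).
Proof.
move=> [l [s [t [st ->]]] [m [q [mL qlm ml qp]]]].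
exists s, t; split => //.
have al0 : 0 < D + t * d by case: st => _ /det_chord_gt0.
have Ea x : det e (b_ x - A) = D + x * d by rewrite /b_ /D /d /det /= !scale_realE; ring.
have key k : (det e ((m k).2 - A) + (D + t * d)) *: (q k - a_ s) =
             det e ((m k).2 - A) *: (b_ t - a_ s).
  have [[s' [t' [st' mkE]]] neq] := mL k.
  have [/= q1 q2] := qlm k.
  rewrite mkE /= in neq q2 *.
  rewrite -Ea; apply: (crossing_point st st' _ q1 q2).
  apply/eqP => ss'; rewrite ss' in st' neq.
  by apply: neq; rewrite (bisecting_params_inj st st').
have m2 := cvg_snd_seq ml; rewrite /= in m2.
have m21 := cvg_fst_seq m2; have m22 := cvg_snd_seq m2.
have q1 := cvg_fst_seq qp; have q2 := cvg_snd_seq qp.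
have cal : (fun k => det e ((m k).2 - A)) @ \oo --> D + t * d.
  rewrite -Ea /det /=; apply: cvgB; apply: cvgMl_tmp; apply: cvgB => //; exact: cvg_cst.
have lim (x : nat -> R) (x0 c : R) : x @ \oo --> x0 ->
   (forall k, (det e ((m k).2 - A) + (D + t * d)) * (x k) = det e ((m k).2 - A) * c) ->
   x0 = 2^-1 * c.
  move=> xx0 xk.
  have L1 : (fun k => (det e ((m k).2 - A) + (D + t * d)) * (x k)) @ \oo -->
     (D + t * d + (D + t * d)) * x0.
    by apply: cvgM => //; apply: cvgD => //; exact: cvg_cst.
  have L2 : (fun k => (det e ((m k).2 - A) + (D + t * d)) * (x k)) @ \oo -->
     (D + t * d) * c.
    by under eq_fun do rewrite xk; exact: cvgMr_tmp.
  have E : (D + t * d + (D + t * d)) * x0 = (D + t * d) * c.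
    exact: (cvg_unique (@norm_hausdorff _ R) L1 L2).
  apply: (mulfI (x := D + t * d)); first by rewrite gt_eqF.
  lra.
apply: plane_eq.
- have /lim h : (fun k => (q k).1 - (a_ s).1) @ \oo --> p.1 - (a_ s).1.
    by apply: cvgB => //; exact: cvg_cst.
  have := h ((b_ t).1 - (a_ s).1) (fun k => congr1 fst (key k)).
  rewrite /midpoint /= !scale_realE; lra.
- have /lim h : (fun k => (q k).2 - (a_ s).2) @ \oo --> p.2 - (a_ s).2.
    by apply: cvgB => //; exact: cvg_cst.
  have := h ((b_ t).2 - (a_ s).2) (fun k => congr1 snd (key k)).
  rewrite /midpoint /= !scale_realE; lra.
Qed.

(* the solution t of the equation of [bisecting_params] *)
Let tau s := s * D / (G - s * d).

Lemma bisecting_params_tau s : 0 <= s <= 1 -> bisecting_params s (tau s).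
Proof.
move=> s01; have b0 := det_foot_gt0 s01; have /andP[s0 s1] := s01.
have E : tau s * (G - s * d) = s * D by rewrite /tau divfK// gt_eqF.
split => //; last by lra.
rewrite /tau; apply/andP; split.
  by apply: divr_ge0; [apply: mulr_ge0 => //|]; exact: ltW.
rewrite ler_pdivrMr // mul1r.
have : s * G <= G by rewrite ler_piMl// ltW.
have -> : s * G = s * D + s * d by rewrite GD; ring.
lra.
Qed.

(** The chords with parameters u k tend to the chord with parameter s, and their
crossing points with it, given by [crossing_point], tend to its midpoint. *)
Lemma midpoint_in_envelope (u : nat -> R) s : 0 <= s <= 1 -> (forall k, 0 <= u k <= 1) ->
  (forall k, u k != s) -> u @ \oo --> s ->
  envelope bisecting_chords (midpoint (a_ s) (b_ (tau s))).
Proof.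
move=> s01 u01 us us_cvg.
have st := bisecting_params_tau s01.
have al0 : 0 < D + tau s * d by case: st => _ /det_chord_gt0.
exists (a_ s, b_ (tau s)); first by exists s, (tau s).
pose al k := D + tau (u k) * d.
have alk0 k : 0 < al k by case: (bisecting_params_tau (u01 k)) => _ /det_chord_gt0.
pose r k := al k / (al k + (D + tau s * d)).
have rE k : r k * (al k + (D + tau s * d)) = al k.
  by rewrite /r divfK// gt_eqF// addr_gt0.
exists (fun k => (a_ (u k), b_ (tau (u k)))).
exists (fun k => a_ s + r k *: (b_ (tau s) - a_ s)).
have tauC : (fun k => tau (u k)) @ \oo --> tau s.
  apply: cvgM; first exact: cvgMr_tmp.
  apply: cvgV; first by rewrite gt_eqF// det_foot_gt0.
  by apply: cvgB; [exact: cvg_cst | exact: cvgMr_tmp].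
have lin (x : nat -> R) (x0 c c' : R) : x @ \oo --> x0 ->
    (fun k => c + x k * c') @ \oo --> c + x0 * c'.
  by move=> xx0; apply: cvgD; [exact: cvg_cst|exact: cvgMr_tmp].
have alC : al @ \oo --> D + tau s * d by exact: lin.
have rC : r @ \oo --> (2^-1 : R).
  have -> : 2^-1 = (D + tau s * d) / (D + tau s * d + (D + tau s * d)).
    have n0 : D + tau s * d + (D + tau s * d) != 0 by rewrite gt_eqF// addr_gt0.
    by apply: (mulIf n0); rewrite divfK//; lra.
  apply: cvgM => //; apply: cvgV; first by rewrite gt_eqF// addr_gt0.
  by apply: cvgD => //; exact: cvg_cst.
split.
- move=> k; split; first by exists (u k), (tau (u k)); split => //; exact: bisecting_params_tau.
  by apply: chord_lines_neq => //; exact: bisecting_params_tau.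
- move=> k; split; rewrite /line /=.
    set w := r k *: _; have -> : a_ s + w - a_ s = w by rewrite addrAC subrr add0r.
    by rewrite detZr /det; ring.
  set w := r k *: _; have -> : a_ s + w - a_ (u k) = w + (a_ s - a_ (u k)).
    by rewrite addrAC [LHS]addrC.
  rewrite /w detDr detZr det_chord_chord det_chord_foot.
  have I := bisecting_params_diff st (bisecting_params_tau (u01 k)).
  have X : (tau (u k) - tau s) * (G - s * d) * r k =
     (u k - s) * (D + tau (u k) * d) * r k by rewrite I.
  have Y : (u k - s) * (r k * (al k + (D + tau s * d))) = (u k - s) * al k by rewrite rE.
  rewrite /al in Y; lra.
- have h1 : (fun k => a_ (u k)) @ \oo --> a_ s by apply: cvg_plane; exact: lin.
  have h2 : (fun k => b_ (tau (u k))) @ \oo --> b_ (tau s).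
    by apply: cvg_plane; exact: lin.
  exact: (cvg_pair h1 h2).
- rewrite (_ : midpoint _ _ = a_ s + 2^-1 *: (b_ (tau s) - a_ s)).
    by apply: cvg_plane; exact: lin.
  by apply: plane_eq; rewrite /midpoint /= !scale_realE; field.
Qed.

Lemma midpoint0_in_envelope : envelope bisecting_chords (midpoint A B).
Proof.
have := @midpoint_in_envelope harmonic 0.
rewrite /tau /a_ /b_ !mul0r !scale0r !addr0; apply.
- by rewrite lexx ler01.
- by move=> k; rewrite harmonic_ge0 /= invf_le1// ler1n.
- by move=> k; rewrite gt_eqF// harmonic_gt0.
- exact: cvg_harmonic.
Qed.

Lemma midpoint1_in_envelope : envelope bisecting_chords (midpoint A' B').
Proof.
have := @midpoint_in_envelope (fun k => 1 - harmonic k) 1.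
have -> : tau 1 = 1 by rewrite /tau !mul1r GD addrK divff// gt_eqF.
rewrite /a_ /b_ !scale1r /e /f !subrKC; apply.
- by rewrite lexx ler01.
- move=> k; have := @harmonic_ge0 R k.
  have : harmonic k <= 1 :> R by rewrite /= invf_le1// ler1n.
  move: (harmonic k) => x; lra.
- move=> k; have := @harmonic_gt0 R k; move: (harmonic k) => x x0.
  by rewrite lt_eqF//; lra.
- rewrite -[X in _ --> X]subr0; apply: cvgB; first exact: cvg_cst.
  exact: cvg_harmonic.
Qed.

(** Since s, t, 1 - s and 1 - t are nonnegative, the midpoint of a bisecting chord
is on the side of both extreme chords indicated by the sign of d. *)
Lemma det_midpoint_chord s t : bisecting_params s t ->
  det (B - A) (midpoint (a_ s) (b_ t) - A) = s * t * d / 2 /\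
  det (B' - A') (midpoint (a_ s) (b_ t) - A') = (1 - s) * (1 - t) * d / 2.
Proof.
move=> [_ _ E]; split.
  have -> : det (B - A) (midpoint (a_ s) (b_ t) - A) = (t * G - s * D) / 2.
    by rewrite /a_ /b_ /D /G /det /midpoint /= !scale_realE; field.
  by rewrite E; congr (_ / _); ring.
have -> : det (B' - A') (midpoint (a_ s) (b_ t) - A') =
   ((1 - s) * (D + d) - (1 - t) * (G - d)) / 2.
  by rewrite /a_ /b_ /D /G /d /e /f /det /midpoint /= !scale_realE; field.
rewrite -{1}GD; have -> : G - d = D by rewrite GD; ring.
have -> : (1 - s) * G = (1 - s) * D + (1 - s) * d by rewrite GD; ring.
move: E; have -> : t * G = t * D + t * d by rewrite GD; ring.
lra.
Qed.

End Arc.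
End ChordEnvelope.

(** * Position of the envelopes with respect to the extreme chords *)

Section Sided.
Context {R : realType}.
Implicit Types (S K T : set (plane R)) (p q a b A B f u v w e : plane R).

Lemma seg_sym p q : seg p q = seg q p.
Proof.
suff H : forall x y : plane R, seg x y `<=` seg y x by apply/seteqP; split; exact: H.
move=> x y z [t /=]; rewrite in_itv/= => /andP[t0 t1] <-; exists (1 - t).
  by rewrite /= in_itv/=; apply/andP; split; lra.
by rewrite subKr addrC.
Qed.

Lemma segP p q x : seg p q x <-> exists t, 0 <= t <= 1 /\ x = p + t *: (q - p).
Proof.
split=> [[t /=]|[t [t01 ->]]].
  rewrite in_itv/= => t01 <-; exists t; split => //.
  by apply: plane_eq; rewrite /= !scale_realE; ring.
exists t; first by rewrite /= in_itv.
by apply: plane_eq; rewrite /= !scale_realE; ring.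
Qed.

Definition side_lines K A A' B B' : set (plane R * plane R) :=
  [set ab | [/\ seg A A' ab.1, seg B B' ab.2 & bisects K ab.1 ab.2]].

(** What the arc of the hyperbolic envelope and the side of the mid-points
envelope have in common: away from its point of contact with an extreme line, S
is strictly on the side of that line indicated by the sign of [A' - A, B' - B]; if this
determinant vanishes, S is reduced to a point. *)
Definition sided A A' B B' S :=
  let d := det (A' - A) (B' - B) in
  [/\ S (midpoint A B), S (midpoint A' B'),
      forall p, S p -> p != midpoint A B -> 0 < d * det (B - A) (p - A)
    & forall p, S p -> p != midpoint A' B' -> 0 < d * det (B' - A') (p - A')].

Definition meets_at (k : R) A A' B B' :=
  (line A B `&` line A' B') !=set0 /\
  forall P, (line A B `&` line A' B') P ->
    P = midpoint A B + k *: (B - A) /\ P = midpoint A' B' - k *: (B' - A').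

Section Quad.
Variables (K : set (plane R)) (A A' B B' : plane R).
Hypotheses (compK : compact K) (convK : plane_convex K).
Hypothesis Q : facing_sides K A A' B B'.
Hypotheses (bisAB : bisects K A B) (bisA'B' : bisects K A' B').

Let e := A' - A.
Let f := B' - B.
Let D := det e (B - A).
Let G := det f (A - B).
Let d := det e f.

Let D0 : 0 < D. Proof. by case: Q. Qed.
Let G0 : 0 < G. Proof. by case: Q. Qed.

Lemma facing_GD : G = D + d.
Proof.
have i1 : (0 : R) <= (1 : R) <= 1 by apply/andP; split; lra.
have /(_ i1 i1) [] := @bisects_chordP _ _ _ _ _ _ compK convK Q bisAB 1 1.
rewrite !scale1r !subrKC => /(_ bisA'B').
rewrite -/e -/f -/D -/G -/d; lra.
Qed.

Lemma bisecting_params00 : bisecting_params A A' B B' 0 0.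
Proof. by split; [apply/andP; split; lra..|rewrite !mul0r subr0]. Qed.

Lemma bisecting_params11 : bisecting_params A A' B B' 1 1.
Proof.
split; [apply/andP; split; lra..|].
by rewrite -/e -/f -/D -/G -/d facing_GD; ring.
Qed.

Lemma side_linesE : side_lines K A A' B B' = bisecting_chords A A' B B'.
Proof.
apply/seteqP; split => -[a b].
  move=> [/= /segP[s [s01 ->]] /segP[t [t01 ->]] bis].
  exists s, t; split => //; split => //.
  exact: (bisects_chordP compK convK Q bisAB s01 t01).1.
move=> [s [t [[s01 t01 E]]]] [-> ->]; split => /=.
- by apply/segP; exists s.
- by apply/segP; exists t.
- exact: (bisects_chordP compK convK Q bisAB s01 t01).2.
Qed.

(** If the sides are parallel, the trapezoid A A' B B' is a parallelogram. *)
Lemma parallel_sides_opp : d = 0 -> e + f = 0.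
Proof.
move=> d0.
have h : det (B - A) (e + f) = 0.
  rewrite (_ : det _ _ = G - D); last by rewrite /G /D /det /=; ring.
  by rewrite facing_GD d0 addr0 subrr.
have := det_collinear e h; rewrite -/D detDr -/d d0.
rewrite (_ : det e e = 0) ?addr0 ?scale0r; last by rewrite /det; ring.
move=> /eqP; rewrite scaler_eq0 gt_eqF //= => /eqP //.
Qed.

(** The points of both envelopes are midpoints of chords with parameters s and t
which vanish simultaneously and reach 1 simultaneously; the distances to the extreme
lines are multiples of d by weights w that vanish only there. *)
Lemma sided_intro S : S (midpoint A B) -> S (midpoint A' B') ->
  (forall p, S p -> exists2 s, 0 <= s <= 1 & exists2 t, 0 <= t <= 1 &
     [/\ p = midpoint (A + s *: e) (B + t *: f),
         d = 0 -> s = t, (s == 0) = (t == 0), (s == 1) = (t == 1) &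
         (exists2 w, s * t != 0 -> 0 < w & det (B - A) (p - A) = w * d) /\
         (exists2 w, (1 - s) * (1 - t) != 0 -> 0 < w & det (B' - A') (p - A') = w * d)]) ->
  sided A A' B B' S.
Proof.
move=> SM SM' H; split => // p /H[s /andP[s0 s1] [t /andP[t0 t1]]];
  rewrite -/e -/f -/d => -[pE d0 st0 st1 [[w wp E1] [w' wp' E2]]] pM.
- have dn0 : d != 0.
    apply: contra pM => /eqP dz; rewrite pE (d0 dz).
    have /eqP := parallel_sides_opp dz; rewrite addrC addr_eq0 => /eqP ->.
    by apply/eqP/plane_eq; rewrite /midpoint /= !scale_realE; ring.
  have sn0 : s != 0.
    apply: contra pM => /eqP s_0; have /esym := st0; rewrite s_0 eqxx => /eqP t_0.
    by rewrite pE s_0 t_0 !scale0r !addr0.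
  have tn0 : t != 0 by rewrite -st0.
  rewrite E1 (_ : d * _ = w * (d ^+ 2)); last by ring.
  by rewrite mulr_gt0 // ?exprn_even_gt0 // wp // mulf_neq0.
- have dn0 : d != 0.
    apply: contra pM => /eqP dz; rewrite pE (d0 dz).
    have H1 := congr1 fst (parallel_sides_opp dz); have H2 := congr1 snd (parallel_sides_opp dz).
    move: H1 H2; rewrite /e /f /= => H1 H2.
    apply/eqP/plane_eq; rewrite /midpoint /= !scale_realE; nra.
  have sn0 : s != 1.
    apply: contra pM => /eqP s_0; have /esym := st1; rewrite s_0 eqxx => /eqP t_0.
    by rewrite pE s_0 t_0 !scale1r /e /f !subrKC.
  have tn0 : t != 1 by rewrite -st1.
  rewrite E2 (_ : d * _ = w' * (d ^+ 2)); last by ring.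
  by rewrite mulr_gt0 // ?exprn_even_gt0 // wp' // mulf_neq0 // subr_eq0 eq_sym.
Qed.

Lemma sided_envelope : sided A A' B B' (envelope (side_lines K A A' B B')).
Proof.
rewrite side_linesE; apply: sided_intro.
- exact: (midpoint0_in_envelope D0 G0 facing_GD).
- exact: (midpoint1_in_envelope D0 G0 facing_GD).
move=> p /(envelope_midpoint D0 G0 facing_GD)[s [t [st pE]]].
have [s01 t01 E] := st; exists s => //; exists t => //; split => //.
- move=> dz; move: E; rewrite -/e -/f -/D -/G -/d facing_GD dz mulr0 subr0 addr0.
  by apply: mulIf; rewrite gt_eqF.
- apply/eqP/eqP => [s_0|t_0].
    by have := bisecting_params00; rewrite -{1}s_0 => /(bisecting_params_inj D0 G0 facing_GD st) ->.
  move: E; rewrite t_0 mulr0 !mul0r subr0 -/e -/D => /eqP.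
  by rewrite mulf_eq0 (gt_eqF D0) orbF => /eqP.
- apply/eqP/eqP => [s_0|t_0].
    by have := bisecting_params11; rewrite -{1}s_0 => /(bisecting_params_inj D0 G0 facing_GD st) ->.
  move: E; rewrite t_0 -/e -/f -/D -/G -/d => E.
  apply: (mulIf (x := G)); first by rewrite gt_eqF.
  rewrite {1}facing_GD; lra.
- have [E1 E2] := det_midpoint_chord facing_GD st; rewrite pE.
  have [/andP[s0 s1] /andP[t0 t1]] := (s01, t01).
  split; [exists (s * t / 2) | exists ((1 - s) * (1 - t) / 2)].
  + by move=> n0; rewrite divr_gt0 // lt_neqAle eq_sym n0 mulr_ge0.
  + by rewrite [LHS]E1 -/d; ring.
  + by move=> n0; rewrite divr_gt0 // lt_neqAle eq_sym n0 mulr_ge0 // subr_ge0.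
  + by rewrite [LHS]E2 -/d; ring.
Qed.

Lemma sided_seg : sided A A' B B' (seg (midpoint A B) (midpoint A' B')).
Proof.
apply: sided_intro.
- by apply/segP; exists 0; split; [apply/andP; split; lra|rewrite scale0r addr0].
- by apply/segP; exists 1; split; [apply/andP; split; lra|rewrite scale1r subrKC].
move=> p /segP[t [t01 pE]].
have pE' : p = midpoint (A + t *: e) (B + t *: f).
  by rewrite pE; apply: plane_eq; rewrite /midpoint /e /f /= !scale_realE; ring.
exists t => //; exists t => //; split => //.
have /andP[t0 t1] := t01.
split; [exists (t / 2) | exists ((1 - t) / 2)].
- rewrite mulf_eq0 negb_or => /andP[n0 _].
  by rewrite divr_gt0 // lt_neqAle eq_sym n0.
- rewrite pE' (_ : det _ _ = (t * G - t * D) / 2).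
    by rewrite facing_GD; ring.
  by rewrite /D /G /e /f /det /midpoint /= !scale_realE; field.
- rewrite mulf_eq0 negb_or => /andP[n0 _].
  by rewrite divr_gt0 // lt_neqAle eq_sym n0 subr_ge0.
- rewrite pE' (_ : det _ _ = ((1 - t) * (D + d) - (1 - t) * (G - d)) / 2).
    by rewrite facing_GD; field.
  by rewrite /D /G /d /e /f /det /midpoint /= !scale_realE; field.
Qed.

Lemma midpoint_neq : d != 0 -> midpoint A B != midpoint A' B'.
Proof.
apply: contra => /eqP MM.
have := congr1 (fun p => det (B - A) (p - A)) MM => /=.
rewrite (_ : det _ _ = 0); last by rewrite /det /midpoint /= !scale_realE; field.
rewrite (_ : det _ _ = (G - D) / 2); last first.
  by rewrite /D /G /e /f /det /midpoint /= !scale_realE; field.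
rewrite facing_GD => h; apply/eqP; lra.
Qed.

(** The diagonals of the trapezoid A A' B B' divide each other in the ratio G : D
of its parallel sides, so that the crossing point is off the midpoints by
multiples of G - D = d. *)
Lemma meets_at_facing : exists2 k, 0 < k & meets_at (k * d) A A' B B'.
Proof.
have GD0 : 0 < G + D by exact: addr_gt0.
have GDn : G + D != 0 by rewrite gt_eqF.
exists (2 * (G + D))^-1; first by rewrite invr_gt0 mulr_gt0.
have Ge : det e (B' - A) = G by rewrite facing_GD /D /d /det /e /f /=; ring.
have De : det e (B - A) = D by [].
split.
  exists (A + (G / (G + D)) *: (B - A)); split; rewrite /line /=.
    by rewrite /det /= !scale_realE; ring.
  set r := G / (G + D).
  have rE : r * (G + D) = G by rewrite /r divfK.
  rewrite (_ : det _ _ = (D + d) - r * (G + D)); last first.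
    by rewrite /D /d /G /e /f /det /= !scale_realE; ring.
  by rewrite rE facing_GD subrr.
move=> P [h h'].
have h0 := bisecting_params00; have h1 := bisecting_params11.
have o1 : (1 : R) != 0 by rewrite oner_neq0.
have o0 : (0 : R) != 1 by rewrite eq_sym oner_neq0.
have := crossing_point D0 G0 facing_GD h0 h1 o1 (q := P).
have := crossing_point D0 G0 facing_GD h1 h0 o0 (q := P).
rewrite !scale1r !scale0r !addr0 !subrKC -/e Ge De => X Y.
have {}X := X h' h; have {}Y := Y h h'.
have {}Y : P - A = (G / (G + D)) *: (B - A).
  apply: (scalerI GDn); rewrite Y scalerA; congr (_ *: _); field.
  exact: GDn.
have {}X : P - A' = (D / (G + D)) *: (B' - A').
  apply: (scalerI GDn); rewrite [G + D]addrC X scalerA; congr (_ *: _); field.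
  by rewrite addrC.
have dE : d = G - D by rewrite facing_GD; ring.
split.
  rewrite -(subrK A P) Y dE; apply: plane_eq; rewrite /midpoint /= !scale_realE; field; exact: GDn.
rewrite -(subrK A' P) X dE; apply: plane_eq; rewrite /midpoint /= !scale_realE; field; exact: GDn.
Qed.

End Quad.
End Sided.

(** * Supporting lines and interior points of a convex set *)

Section Supporting.
Context {R : realType}.
Notation mu := (@lebesgue_measure R).
Local Notation P2 := (measurableTypeR R * measurableTypeR R)%type.
Implicit Types (S K T : set (plane R)) (p q a b A B f u v w e x : plane R).

Lemma sqr_norm_gt0 e : e != 0 -> 0 < e.1 ^+ 2 + e.2 ^+ 2.
Proof.
move=> e0; rewrite lt_neqAle addr_ge0 ?sqr_ge0 // andbT eq_sym paddr_eq0 ?sqr_ge0 //.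
rewrite !sqrf_eq0; apply: contra e0 => /andP[/eqP h1 /eqP h2].
by apply/eqP/plane_eq.
Qed.

Lemma near_det_gt0 u a (m : plane R) : 0 < det u (m - a) ->
  \forall x \near m, 0 < det u (x - a).
Proof.
move=> h.
have c : (fun x : plane R => det u (x - a)) @ m --> det u (m - a).
  apply: cvgB; apply: cvgMl_tmp; apply: cvgB; try exact: cvg_cst.
    exact: cvg_snd.
  exact: cvg_fst.
exact: (cvgr_gt _ c).
Qed.

Lemma triangle_in K A A' p x : plane_convex K ->
  K A -> K A' -> K p -> 0 < det (A' - A) (p - A) ->
  0 <= det (A' - A) (x - A) -> 0 <= det (p - A') (x - A') -> 0 <= det (A - p) (x - p) -> K x.
Proof.
move=> cK KA KA' Kp D0 al be ga.
set D := det (A' - A) (p - A) in D0.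
have E : det (p - A') (x - A') = D - det (A' - A) (x - A) - det (A - p) (x - p).
  by rewrite /D /det /=; ring.
have Dn : D != 0 by rewrite gt_eqF.
have -> : x = A + (det (A' - A) (x - A) / D) *: (p - A) +
              (det (A - p) (x - p) / D) *: (A' - A).
  apply: (scalerI Dn); rewrite !scalerDr !scalerA ![D * (_ / D)]mulrC !divfK //.
  by apply: plane_eq; rewrite /= !scale_realE /D /det /=; ring.
apply: convex_triangle => //; try by apply: divr_ge0 => //; exact: ltW.
by rewrite -mulrDl ler_pdivrMr // mul1r; lra.
Qed.

(** The segment A A' is a diagonal of the quadrilateral A q A' p contained in K:
near its midpoint, every point is in one of the triangles A A' p and A' A q. *)
Lemma interior_of_two_sides K A A' p q :
  plane_convex K ->
  K A -> K A' -> K p -> K q -> 0 < det (A' - A) (p - A) -> det (A' - A) (q - A) < 0 ->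
  interior K (midpoint A A').
Proof.
move=> cK KA KA' Kp Kq Dp Dq; rewrite /interior /=.
set m := midpoint A A'.
have h1 : 0 < det (p - A') (m - A').
  rewrite (_ : det _ _ = det (A' - A) (p - A) / 2); first by rewrite divr_gt0.
  by rewrite /m /midpoint /det /= !scale_realE; field.
have h2 : 0 < det (A - p) (m - p).
  rewrite (_ : det _ _ = det (A' - A) (p - A) / 2); first by rewrite divr_gt0.
  by rewrite /m /midpoint /det /= !scale_realE; field.
have h3 : 0 < det (q - A) (m - A).
  rewrite (_ : det _ _ = - det (A' - A) (q - A) / 2); first by rewrite divr_gt0 // oppr_gt0.
  by rewrite /m /midpoint /det /= !scale_realE; field.
have h4 : 0 < det (A' - q) (m - q).
  rewrite (_ : det _ _ = - det (A' - A) (q - A) / 2); first by rewrite divr_gt0 // oppr_gt0.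
  by rewrite /m /midpoint /det /= !scale_realE; field.
have Dq' : 0 < det (A - A') (q - A').
  rewrite (_ : det _ _ = - det (A' - A) (q - A)); first by rewrite oppr_gt0.
  by rewrite /det /=; ring.
near=> x.
have x1 : 0 < det (p - A') (x - A') by near: x; exact: near_det_gt0.
have x2 : 0 < det (A - p) (x - p) by near: x; exact: near_det_gt0.
have x3 : 0 < det (q - A) (x - A) by near: x; exact: near_det_gt0.
have x4 : 0 < det (A' - q) (x - q) by near: x; exact: near_det_gt0.
(* the line A A' tells in which of the two triangles x is *)
have [s|s] := lerP 0 (det (A' - A) (x - A)).
  by apply: (triangle_in cK KA KA' Kp Dp s); exact: ltW.
apply: (triangle_in cK KA' KA Kq Dq' _ (ltW x3) (ltW x4)).
rewrite (_ : det _ _ = - det (A' - A) (x - A)); first by rewrite oppr_ge0 ltW.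
by rewrite /det /=; ring.
Unshelve. all: by end_near. Qed.

Lemma interior_strict K e A x : e != 0 -> (forall p, K p -> 0 <= det e (p - A)) ->
  interior K x -> 0 < det e (x - A).
Proof.
move=> e0 sup Kx.
have := sup _ (interior_subset Kx); rewrite le_eqVlt => /orP[/eqP z|//].
(* w points across the line towards its forbidden side *)
pose w : plane R := (e.2, - e.1).
have ww := sqr_norm_gt0 e0.
have c : (fun k => x + harmonic k *: w) @ \oo --> x.
  have lin (c c' : R) : (fun k => c + harmonic k * c') @ \oo --> c.
    rewrite -[X in _ --> X]addr0; apply: cvgD; first exact: cvg_cst.
    by rewrite -(mul0r c'); apply: cvgMr_tmp; exact: cvg_harmonic.
  by apply: cvg_plane; exact: lin.
have [N _ H] := c _ Kx.
have /sup := H N (leqnn N).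
rewrite (_ : det _ _ = det e (x - A) - harmonic N * (e.1 ^+ 2 + e.2 ^+ 2)).
  rewrite -z sub0r oppr_ge0 leNgt mulr_gt0 // harmonic_gt0 //.
by rewrite /det /= !scale_realE; ring.
Qed.

Lemma area_interior_gt0 K S x : compact K -> interior K x -> measurable (S : set P2) ->
  interior K `<=` S -> (0 < area (K `&` S))%E.
Proof.
move=> cK Kx mS KS.
have : nbhs x (interior K) by apply: nbhs_interior.
move=> /nbhs_ballP[r /= r0 rK].
apply: (area_gt0 (p := x) r0); first by apply: measurableI => //; exact: compact_plane_measurable.
by move=> y /rK Ky; split; [exact: interior_subset|exact: KS].
Qed.

(** Otherwise a b would be the supporting line itself, with nothing of K on one
side and, because K has interior points, a positive area on the other. *)
Lemma bisector_not_supporting K e A a b : compact K -> interior K !=set0 -> e != 0 ->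
  (forall p, K p -> 0 <= det e (p - A)) -> det e (a - A) = 0 -> det e (b - A) = 0 ->
  ~ bisects K a b.
Proof.
move=> cK [x Kx] e0 sup ha hb [ab].
have eab : det e (b - a) = 0.
  rewrite (_ : det _ _ = det e (b - A) - det e (a - A)); first by rewrite ha hb subrr.
  by rewrite /det /=; ring.
have ww := sqr_norm_gt0 e0.
have col := parallel_dot eab; set k := (X in _ = X *: e) in col.
have k0 : k != 0.
  apply: contra ab => /eqP kz; move: col; rewrite kz scale0r => /eqP.
  by rewrite scaler_eq0 gt_eqF //= subr_eq0 eq_sym.
have main p : (e.1 ^+ 2 + e.2 ^+ 2) * det (b - a) (p - a) = k * det e (p - A).
  rewrite (parallel_det _ col); congr (_ * _).
  rewrite (_ : det e (p - A) = det e (p - a) + det e (a - A)); first by rewrite ha addr0.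
  by rewrite /det /=; ring.
move=> areas.
have emp S : K `&` S = set0 -> area (K `&` S) = 0%E.
  by move=> ->; rewrite /area (@measure0 _ _ _ (mu \x mu)%E).
have [kn|kp|/eqP] := ltrgtP k 0; last by rewrite (negPf k0).
- have : (0 < area (K `&` right_side a b))%E.
    apply: area_interior_gt0 Kx _ _ => //.
      by rewrite right_sideE; exact: measurable_left_side.
    move=> y /(interior_strict e0 sup) ey; rewrite /right_side /=.
    by rewrite -(pmulr_rlt0 _ ww) main nmulr_rlt0.
  rewrite -areas emp ?ltxx //; apply/seteqP; split => // y [/sup ey].
  rewrite /left_side /= -(pmulr_rgt0 _ ww) main ltNge => /negP; apply.
  by rewrite nmulr_rle0.
- have : (0 < area (K `&` left_side a b))%E.
    apply: area_interior_gt0 Kx (measurable_left_side a b) _ => // y.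
    move=> /(interior_strict e0 sup) ey; rewrite /left_side /=.
    by rewrite -(pmulr_rgt0 _ ww) main mulr_gt0.
  rewrite areas emp ?ltxx //; apply/seteqP; split => // y [/sup ey].
  rewrite /right_side /= -(pmulr_rlt0 _ ww) main ltNge => /negP; apply.
  by rewrite pmulr_rge0.
Qed.
End Supporting.

(** * From the polygon to its pairs of opposite sides *)

Section Polygon0.
Context {R : realType}.
Implicit Types (S K T : set (plane R)) (p q a b A B f u v w e x : plane R).

Lemma sided_swap A A' B B' S : sided A' A B' B S -> sided A A' B B' S.
Proof.
rewrite /sided (_ : det (A - A') (B - B') = det (A' - A) (B' - B)).
  by case=> ? ? ? ?; split.
by rewrite /det /=; ring.
Qed.

Lemma meets_at_swap (k : R) A A' B B' : meets_at k A' A B' B -> meets_at (- k) A A' B B'.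
Proof.
move=> [ne H]; split; first by rewrite setIC.
by move=> P; rewrite setIC => /H[h1 h2]; rewrite !scaleNr opprK.
Qed.

Lemma side_lines_swap K A A' B B' : side_lines K A' A B' B = side_lines K A A' B B'.
Proof. by rewrite /side_lines (seg_sym A') (seg_sym B'). Qed.

Lemma seg_across p v (x y : R) : v != 0 ->
  seg (p - x *: v) (p + y *: v) p <-> 0 <= x * y.
Proof.
move=> v0; split => [/segP[t [/andP[t0 t1] pE]]|xy].
  have : (t * y - (1 - t) * x) *: v = 0.
    rewrite (_ : _ *: v = p - x *: v + t *: (p + y *: v - (p - x *: v)) - p).
      by rewrite -pE subrr.
    by apply: plane_eq; rewrite /= !scale_realE; ring.
  move=> /eqP; rewrite scaler_eq0 (negPf v0) orbF subr_eq0 => /eqP E.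
  have -> : x * y = t * y ^+ 2 + (1 - t) * x ^+ 2.
    have -> : t * y ^+ 2 = (1 - t) * x * y by rewrite -E; ring.
    have -> : (1 - t) * x ^+ 2 = x * (t * y) by rewrite E; ring.
    by ring.
  by rewrite addr_ge0 // mulr_ge0 ?sqr_ge0 // subr_ge0.
apply/segP; have [xy0|xy0] := eqVneq (x + y) 0.
  have xx : x = 0.
    apply/eqP; rewrite -sqrf_eq0 eq_le sqr_ge0 andbT.
    have -> : x ^+ 2 = - (x * y) + x * (x + y) by ring.
    by rewrite xy0 mulr0 addr0 oppr_le0.
  by exists 0; rewrite lexx ler01 scale0r xx scale0r subr0 addr0.
exists (x / (x + y)); split; last first.
  by apply: plane_eq; rewrite /= !scale_realE; field.
have x2 : 0 < (x + y) ^+ 2 by rewrite exprn_even_gt0.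
have -> : x / (x + y) = (x ^+ 2 + x * y) / (x + y) ^+ 2 by field.
rewrite divr_ge0 ?addr_ge0 ?sqr_ge0 //= ler_pdivrMr // mul1r.
have := sqr_ge0 y; have -> : (x + y) ^+ 2 = x ^+ 2 + x * y + (x * y + y ^+ 2) by ring.
lra.
Qed.

Lemma separates_sided a b p q q' S T (d d' : R) :
  S q -> (d != 0 -> q != p) -> (forall x, S x -> x != p -> 0 < d * det (b - a) (x - a)) ->
  T q' -> (d' != 0 -> q' != p) -> (forall x, T x -> x != p -> 0 < d' * det (b - a) (x - a)) ->
  separates a b p S T <-> d * d' < 0.
Proof.
move=> Sq qp HS Tq' q'p HT; split.
  case=> -[x [Sx /eqP xp]] [y [Ty /eqP yp]].
  have hx := HS x Sx xp; have hy := HT y Ty yp.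
  case=> -[hl hr].
    have lx : 0 < det (b - a) (x - a) by apply: hl; split => //; apply/eqP.
    have ry : det (b - a) (y - a) < 0 by apply: hr; split => //; apply/eqP.
    move: hx hy; rewrite (pmulr_lgt0 _ lx) (nmulr_lgt0 _ ry) => ? ?.
    by rewrite nmulr_llt0.
  have lx : det (b - a) (x - a) < 0 by apply: hl; split => //; apply/eqP.
  have ry : 0 < det (b - a) (y - a) by apply: hr; split => //; apply/eqP.
  move: hx hy; rewrite (nmulr_lgt0 _ lx) (pmulr_lgt0 _ ry) => ? ?.
  by rewrite pmulr_llt0.
move=> dd'.
have d0 : d != 0 by apply: contraTneq dd' => ->; rewrite mul0r ltxx.
have d'0 : d' != 0 by apply: contraTneq dd' => ->; rewrite mulr0 ltxx.
split.
- by exists q; split => //; apply/eqP; exact: qp.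
- by exists q'; split => //; apply/eqP; exact: q'p.
have [dn|dp|/eqP] := ltrgtP d 0; last by rewrite (negPf d0).
  have d'p : 0 < d' by rewrite nmulr_rlt0 in dd'.
  right; split => x [hx /eqP xp].
    by have := HS x hx xp; rewrite nmulr_rgt0.
  by have := HT x hx xp; rewrite pmulr_rgt0.
have d'n : d' < 0 by rewrite pmulr_rlt0 in dd'.
left; split => x [hx /eqP xp].
  by have := HS x hx xp; rewrite pmulr_rgt0.
by have := HT x hx xp; rewrite nmulr_rgt0.
Qed.

Lemma bisects_sym K a b : bisects K a b -> bisects K b a.
Proof. by move=> [ab E]; split; [rewrite eq_sym | rewrite -right_sideE -E right_sideE]. Qed.

Section Polygon.
Variables (n : nat) (g : 'Z_(2 * n) -> plane R) (K : set (plane R)).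
Hypothesis hg : half_area_polygon g K.
Implicit Types i j : 'Z_(2 * n).

Let cK : compact K. Proof. by case: hg => -[_ [? _] _ _ _]. Qed.
Let convK : plane_convex K.
Proof. by case: hg => -[_ [_ ?] _ _ _]. Qed.
Let intK : interior K !=set0. Proof. by case: hg => -[]. Qed.
Let bis i : bisects K (g i) (g (opp_index i)). Proof. by case: hg. Qed.

Lemma side_boundary i p : side g i p -> K p /\ ~ interior K p.
Proof.
move=> gp; have : boundary K p by case: hg => -[_ _ _ -> _] _; exists i.
rewrite /boundary (_ : closure K = K) //.
by apply/esym/closure_id; exact: compact_closed.
Qed.

Lemma vertex_in i : K (g i).
Proof.
by have [] : K (g i) /\ ~ interior K (g i) => //; apply: (@side_boundary i);
  apply/segP; exists 0; rewrite lexx ler01 scale0r addr0.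
Qed.

(** For s = 1 the region is on the left of the side i + 1/2, for s = -1 on its
right. *)
Definition orient (s : R) i := forall p, K p -> 0 <= s * det (edge g i) (p - g i).

(** Points of the region on both sides of the line of a side would make the
midpoint of this side an interior point. *)
Lemma orient_or i : orient 1 i \/ orient (-1) i.
Proof.
have [h|/existsNP[q /not_implyP[Kq /negP]]] := pselect (orient 1 i); first by left.
rewrite mul1r -ltNge => Dq; right => p Kp; rewrite mulN1r oppr_ge0 leNgt; apply/negP => Dp.
have [] : K (midpoint (g i) (g (i + 1))) /\ ~ interior K (midpoint (g i) (g (i + 1))).
  apply: (@side_boundary i); apply/segP; exists 2^-1; split.
    by apply/andP; split; lra.
  by apply: plane_eq; rewrite /midpoint /= !scale_realE; field.
move=> _; apply; exact: (interior_of_two_sides convK (vertex_in i) (vertex_in _) Kp Kq).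
Qed.

Lemma succ_neq i : i + 1 != i.
Proof. by rewrite -subr_eq0 addrAC subrr add0r oner_neq0. Qed.

Lemma edge_neq0 i : edge g i != 0.
Proof.
have inj : injective g by case: hg => -[].
by rewrite subr_eq0; apply: contra (succ_neq i) => /eqP /inj ->.
Qed.

Lemma orient_strict (s : R) i x : s != 0 -> orient s i -> interior K x ->
  0 < s * det (edge g i) (x - g i).
Proof.
move=> s0 so Kx; have E p : det (s *: edge g i) (p - g i) = s * det (edge g i) (p - g i).
  by rewrite /det /= !scale_realE; ring.
rewrite -E; apply: interior_strict Kx.
  by rewrite scaler_eq0 negb_or s0 edge_neq0.
by move=> p Kp; rewrite E; exact: so.
Qed.

(** A change of orientation at g (i + 1) forces both sides to be collinear.  If
they have the same direction, then K is contained in a line; if they have opposite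
directions, then they overlap. *)
Lemma orient_succ (s : R) i : s != 0 -> orient s i -> ~ orient (- s) (i + 1).
Proof.
move=> s0 so so'.
have [x Kx] := intK.
have hx := orient_strict s0 so Kx.
have hx' : 0 < - s * det (edge g (i + 1)) (x - g (i + 1)).
  by apply: orient_strict => //; rewrite oppr_eq0.
set A := g i in hx *; set A' := g (i + 1) in hx' *; set A'' := g (i + 1 + 1).
have eE : edge g i = A' - A by [].
have e'E : edge g (i + 1) = A'' - A' by [].
set e := edge g i in eE hx; set e' := edge g (i + 1) in e'E hx'.
have ee' : det e e' = 0.
  have := so A'' (vertex_in _); have := so' A (vertex_in _).
  rewrite -/e -/e' -/A -/A'.
  rewrite (_ : - s * det e' (A - A') = - (s * det e e')); last first.
    by rewrite eE e'E /det /=; ring.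
  rewrite (_ : s * det e (A'' - A) = s * det e e'); last first.
    by rewrite eE e'E /det /=; ring.
  rewrite oppr_ge0 => h1 h2.
  have /eqP : s * det e e' == 0 by rewrite eq_le h1.
  by move=> /eqP; rewrite mulf_eq0 (negPf s0) => /eqP.
pose W := e.1 ^+ 2 + e.2 ^+ 2; pose k := e.1 * e'.1 + e.2 * e'.2.
have W0 : 0 < W by apply: sqr_norm_gt0; exact: edge_neq0.
have col : W *: e' = k *: e by exact: parallel_dot.
(* in the same direction, K would lie on both sides of the common line *)
have kn : k < 0.
  rewrite ltNge; apply/negP => k0.
  have E : W * det e' (x - A') = k * det e (x - A).
    have -> : det e (x - A) = det e (x - A').
      by rewrite eE /det /=; ring.
    exact: parallel_det.
  have : 0 < W * (- s * det e' (x - A')) by rewrite mulr_gt0.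
  have -> : W * (- s * det e' (x - A')) = - (s * (W * det e' (x - A'))) by ring.
  have hk : 0 <= k * (s * det e (x - A)) by rewrite mulr_ge0 // ltW.
  rewrite E oppr_gt0 => hh; have : s * (k * det e (x - A)) = k * (s * det e (x - A)) by ring.
  lra.
pose r := - k / W.
have r0 : 0 < r by rewrite /r divr_gt0 // oppr_gt0.
have A''E : A'' - A' = r *: (A - A').
  have Wn : W != 0 by rewrite gt_eqF.
  apply: (scalerI Wn); rewrite -e'E col scalerA /r mulrCA divff // mulr1.
  by rewrite scaleNr -scalerN opprB -eE.
(* a point close enough to A' is on both sides and differs from A' and A'' *)
pose h := Num.min 1 r / 2.
have m0 : 0 < Num.min 1 r by rewrite lt_min ltr01.
have m1 : Num.min 1 r <= 1 by rewrite ge_min lexx.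
have mr : Num.min 1 r <= r by rewrite ge_min lexx orbT.
have h0 : 0 < h by rewrite divr_gt0.
have h1 : h < 1 by rewrite /h; lra.
have hr : h < r by rewrite /h; lra.
have AA' : A - A' != 0 by rewrite -opprB -eE oppr_eq0 edge_neq0.
pose y := A' + h *: (A - A').
have triv : trivIset setT (fun j => side g j `\ g (j + 1)) by case: hg => -[].
have /eqP := succ_neq i; apply.
apply: triv => //; exists y; split; split.
- apply/segP; exists (h / r); split.
    apply/andP; split; first by apply: divr_ge0; exact: ltW.
    by rewrite ler_pdivrMr // mul1r ltW.
  rewrite -/A' -/A'' A''E scalerA divfK // gt_eqF //.
- rewrite -/A'' => yA; have : (h - r) *: (A - A') = 0.
    rewrite scalerBl -A''E (_ : A'' - A' = h *: (A - A')) ?subrr //.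
    by rewrite -yA /y addrAC subrr add0r.
  by move=> /eqP; rewrite scaler_eq0 (negPf AA') orbF subr_eq0 lt_eqF.
- apply/segP; exists (1 - h); split; first by apply/andP; split; lra.
  by apply: plane_eq; rewrite /y /A /A' /= !scale_realE; ring.
- move=> /eqP; rewrite -subr_eq0 /y -/A' addrAC subrr add0r.
  by rewrite scaler_eq0 (negPf AA') gt_eqF.
Qed.

Lemma orient_ex : exists2 s : R, s = 1 \/ s = -1 & forall i, orient s i.
Proof.
have [s [s1 s0]] : exists s : R, (s = 1 \/ s = -1) /\ orient s 0.
  by case: (orient_or 0) => h; [exists 1|exists (-1)]; split => //; [left|right].
exists s => // i.
have -> : i = (nat_of_ord i)%:R by rewrite natr_Zp.
elim: (nat_of_ord i) => // m IH; rewrite mulrSr.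
have sn : s != 0 by case: s1 => ->; rewrite ?oppr_eq0 oner_neq0.
have := orient_succ sn IH; case: s1 => -> /=.
  by case: (orient_or (m%:R + 1)).
by rewrite opprK; case: (orient_or (m%:R + 1)).
Qed.

Lemma opp_index_succ i : opp_index (i + 1) = opp_index i + 1.
Proof. by rewrite /opp_index addrAC. Qed.

(** By [bisector_not_supporting], the second endpoint of a bisecting chord is not on
the line of a side passing through the first one. *)
Lemma orient_off (s : R) i a b : s = 1 \/ s = -1 -> orient s i -> bisects K a b ->
  K a -> det (edge g i) (b - g i) = 0 -> 0 < s * det (edge g i) (a - g i).
Proof.
move=> s1 so ab Ka bi; have s0 : s != 0 by case: s1 => ->; rewrite ?oppr_eq0 oner_neq0.
rewrite lt_neqAle so // andbT eq_sym mulf_neq0 //; apply/eqP => ai.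
have E p : det (s *: edge g i) (p - g i) = s * det (edge g i) (p - g i).
  by rewrite /det /= !scale_realE; ring.
apply: (bisector_not_supporting cK intK (e := s *: edge g i) (A := g i) _ _ _ _ ab).
- by rewrite scaler_eq0 negb_or s0 edge_neq0.
- by move=> p Kp; rewrite E; exact: so.
- by rewrite E ai mulr0.
- by rewrite E bi mulr0.
Qed.

(** The sign s, the orientation of the boundary, is common to all indices; this is
what allows comparing the pairs of opposite sides at i - 1 and at i. *)
Lemma facing_data : exists2 s : R, s ^+ 2 = 1 & forall i,
  [/\ exists2 k, 0 < k & meets_at (s * k * delta g i) (g i) (g (i + 1))
        (g (opp_index i)) (g (opp_index i + 1)),
      sided (g i) (g (i + 1)) (g (opp_index i)) (g (opp_index i + 1)) (H_arc g K i),
      sided (g i) (g (i + 1)) (g (opp_index i)) (g (opp_index i + 1)) (M_seg g i)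
    & delta g i != 0 -> M g i != M g (i + 1)].
Proof.
have [s s1 so] := orient_ex; exists s; first by case: s1 => ->; rewrite ?sqrrN expr1n.
move=> i; rewrite /H_arc /M_seg /M opp_index_succ.
have b1 := bis i; have b2 := bis (i + 1); rewrite opp_index_succ in b2.
have eA : det (edge g i) (g i - g i) = 0 by rewrite subrr /det /=; ring.
have eA' : det (edge g i) (g (i + 1) - g i) = 0 by rewrite /edge /det; ring.
have fB : det (edge g (opp_index i)) (g (opp_index i) - g (opp_index i)) = 0.
  by rewrite subrr /det /=; ring.
have fB' : det (edge g (opp_index i)) (g (opp_index i + 1) - g (opp_index i)) = 0.
  by rewrite /edge /det; ring.
have p1 := orient_off s1 (so i) (bisects_sym b1) (vertex_in _) eA.
have p2 := orient_off s1 (so i) (bisects_sym b2) (vertex_in _) eA'.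
have p3 := orient_off s1 (so (opp_index i)) b1 (vertex_in _) fB.
have p4 := orient_off s1 (so (opp_index i)) b2 (vertex_in _) fB'.
have soi := so i; have soj := so (opp_index i).
rewrite /orient in soi soj.
have H k v w : 0 <= - 1 * det v w -> k = - det v w -> 0 <= k by rewrite mulN1r => ? ->.
have H' k v w : 0 < - 1 * det v w -> k = - det v w -> 0 < k by rewrite mulN1r => ? ->.
case: s1 => sE; subst s.
- have Q : facing_sides K (g i) (g (i + 1)) (g (opp_index i)) (g (opp_index i + 1)).
    split; try exact: vertex_in.
    + by move=> p /soi; rewrite mul1r.
    + by move=> p /soj; rewrite mul1r.
    + by rewrite mul1r in p1.
    + by rewrite mul1r in p2.
    + by rewrite mul1r in p3.
    + by rewrite mul1r in p4.
  split.
  + have [k k0 h] := meets_at_facing cK convK Q b1 b2.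
    by exists k => //; rewrite mul1r.
  + exact: (sided_envelope cK convK Q b1 b2).
  + exact: (sided_seg cK convK Q b1 b2).
  + exact: (midpoint_neq cK convK Q b1 b2).
- have Q : facing_sides K (g (i + 1)) (g i) (g (opp_index i + 1)) (g (opp_index i)).
    split; try exact: vertex_in.
    + by move=> p /soi/H; apply; rewrite /edge /det /=; ring.
    + by move=> p /soj/H; apply; rewrite /edge /det /=; ring.
    + by apply: (H' _ _ _ p2); rewrite /edge /det /=; ring.
    + by apply: (H' _ _ _ p1); rewrite /edge /det /=; ring.
    + by apply: (H' _ _ _ p4); rewrite /edge /det /=; ring.
    + by apply: (H' _ _ _ p3); rewrite /edge /det /=; ring.
  have dE : det (g i - g (i + 1)) (g (opp_index i) - g (opp_index i + 1)) = delta g i.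
    by rewrite /delta /edge /det /=; ring.
  split.
  + have [k k0 h] := meets_at_facing cK convK Q b2 b1.
    by exists k => //; rewrite mulN1r mulNr -dE; exact: meets_at_swap.
  + apply: sided_swap; rewrite /side_bisectors.
    have := sided_envelope cK convK Q b2 b1; by rewrite side_lines_swap.
  + by apply: sided_swap; rewrite seg_sym; exact: (sided_seg cK convK Q b2 b1).
  + move=> d0; rewrite eq_sym; apply: (midpoint_neq cK convK Q b2 b1).
    by rewrite dE.
Qed.

(** The displacements of the endpoints of E(i) from M(i) are multiples of the
vector from g i to g (i + n) by numbers with the signs of
- s delta(i - 1/2) and s delta(i + 1/2): M(i) is outside E(i) when these two signs
are equal, that is, when the deltas have opposite signs.  For the cusps, the line l(i)
is the second extreme chord of the pair i - 1/2 and the first one of the pair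
i + 1/2. *)
Lemma half_areaP i :
  [/\ ~ E_seg g i (M g i) <-> half_area_vertex g i,
      M_cusp g i <-> half_area_vertex g i & H_cusp g K i <-> half_area_vertex g i].
Proof.
have [s s2 data] := facing_data.
have := data (i - 1); rewrite -opp_index_succ subrK.
move=> [[k k0 [ne kE]] [HS HS' _ HSr] [MS MS' _ MSr] Mn].
have [[k' k'0 [ne' kE']] [HT' HT HTl _] [MT' MT MTl _] Mn'] := data i.
rewrite [M g (i + 1)]/M opp_index_succ in Mn'.
have dE : delta g (i - 1) = det (g i - g (i - 1)) (g (opp_index i) - g (opp_index (i - 1))).
  by rewrite /delta /edge -opp_index_succ subrK.
have AB : g (opp_index i) - g i != 0 by have [] := bis i; rewrite subr_eq0 eq_sym.
rewrite /half_area_vertex; split.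
- have P1 : E_vertex g (i - 1) =
      M g i - (s * k * delta g (i - 1)) *: (g (opp_index i) - g i).
    by rewrite /E_vertex /bisector subrK; exact: (kE _ (getPex ne)).2.
  have P2 : E_vertex g i = M g i + (s * k' * delta g i) *: (g (opp_index i) - g i).
    by rewrite /E_vertex /bisector opp_index_succ; exact: (kE' _ (getPex ne')).1.
  rewrite /E_seg P1 P2.
  have E : (s * k * delta g (i - 1)) * (s * k' * delta g i) =
      k * k' * (delta g (i - 1) * delta g i).
    rewrite (_ : _ * (s * k' * _) = s ^+ 2 * (k * k' * (delta g (i - 1) * delta g i))).
      by rewrite s2 mul1r.
    by ring.
  have kk' : 0 < k * k' by rewrite mulr_gt0.
  have := @seg_across (M g i) _ (s * k * delta g (i - 1)) (s * k' * delta g i) AB.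
  rewrite E pmulr_rge0 // => -[h1 h2]; split => [h|h /h1].
    by rewrite ltNge; apply/negP => /h2.
  by rewrite leNgt h.
- rewrite dE; apply: (separates_sided MS _ MSr MT _ MTl) => d0.
    by apply: Mn; rewrite dE.
  by rewrite eq_sym Mn'.
- rewrite dE; apply: (separates_sided HS _ HSr HT _ HTl) => d0.
    by apply: Mn; rewrite dE.
  by rewrite eq_sym Mn'.
Qed.

End Polygon.
End Polygon0.

Theorem corollary4p4 (R : realType) (n : nat) (hn : (2 <= n)%N)
    (g : 'Z_(2 * n) -> plane R) (K : set (plane R))
    (hg : half_area_polygon g K) (i : 'Z_(2 * n)) :
  [<-> half_area_vertex g i;
       ~ E_seg g i (M g i);
       M_cusp g i;
       H_cusp g K i].
Proof.
have [H2 H3 H4] := half_areaP hg i.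
by tfae; rewrite ?H2 ?H3 ?H4.
Qed.
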